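(* Let $A$ be a unital AF algebra. Let $\alpha \colon G \to \mathrm{Aut}(A)$ be an action of a finite group $G$ on $A$ which has the strict Rokhlin property. Then $C^*(G, A, \alpha)$ is an AF algebra.
   Context: Strict Rokhlin property: Let $A$ be a separable unital C*-algebra, and let $\alpha \colon G \to \mathrm{Aut}(A)$ be an action of a finite group $G$ on $A$. Then $\alpha$ has the strict Rokhlin property if for every finite set $F \subset A$ and every $\varepsilon > 0$, there are mutually orthogonal projections $e_g \in A$ for $g \in G$ such that: (1) $\|\alpha_g(e_h) - e_{gh}\| < \varepsilon$ for all $g, h \in G$; (2) $\|e_g a - a e_g\| < \varepsilon$ for all $g \in G$ and all $a \in F$; (3) $\sum_{g \in G} e_g = 1$. AF algebras are taken to be separable. *)

(* Defs.v *)
From HB Require Import structures.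
From mathcomp Require Import all_boot all_order all_fingroup all_algebra.
From mathcomp Require Import complex.
From mathcomp Require Import all_classical all_reals all_analysis.

Set Implicit Arguments.
Unset Strict Implicit.
Unset Printing Implicit Defensive.

Import Order.TTheory GRing.Theory Num.Theory.
Import numFieldNormedType.Exports.

Local Open Scope classical_set_scope.
Local Open Scope ring_scope.
Local Open Scope complex_scope.

(* Norms on modules over R[i] take their values in R[i]; in R[i], [0 <= x]
   and [0 < x] entail that [x] is real. *)

(* The zero algebra, in which [1 = 0], is not excluded.  The multiplication is
   a field of the record rather than part of a Hierarchy Builder structure
   because no structure declared after [numDomainType] can join rings and
   normed modules; the carrier is made a [pzRingType] just below. *)
Record unitalCStarType (R : realType) := UnitalCStar {
  cstar_carrier : completeNormedModType R[i];
  cstar_one : cstar_carrier;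
  cstar_mul : cstar_carrier -> cstar_carrier -> cstar_carrier;
  cstar_star : cstar_carrier -> cstar_carrier;
  cstar_mulA : associative cstar_mul;
  cstar_mul1l : left_id cstar_one cstar_mul;
  cstar_mul1r : right_id cstar_one cstar_mul;
  cstar_mulDl : left_distributive cstar_mul +%R;
  cstar_mulDr : right_distributive cstar_mul +%R;
  cstar_mulZl : forall (c : R[i]) x y,
    cstar_mul (c *: x) y = c *: cstar_mul x y;
  cstar_mulZr : forall (c : R[i]) x y,
    cstar_mul x (c *: y) = c *: cstar_mul x y;
  cstar_starD : {morph cstar_star : x y / x + y};
  cstar_starZ : forall (c : R[i]) x, cstar_star (c *: x) = c^* *: cstar_star x;
  cstar_starM : forall x y,
    cstar_star (cstar_mul x y) = cstar_mul (cstar_star y) (cstar_star x);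
  cstar_starK : involutive cstar_star;
  cstar_normM : forall x y, `|cstar_mul x y| <= `|x| * `|y|;
  cstar_identity : forall x, `|cstar_mul (cstar_star x) x| = `|x| ^+ 2
}.

Definition cstar_sort (R : realType) (A : unitalCStarType R) : Type :=
  cstar_carrier A.
Coercion cstar_sort : unitalCStarType >-> Sortclass.

HB.instance Definition _ (R : realType) (A : unitalCStarType R) :=
  CompleteNormedModule.copy (cstar_sort A) (cstar_carrier A).
HB.instance Definition _ (R : realType) (A : unitalCStarType R) :=
  GRing.Zmodule_isPzRing.Build (cstar_sort A) (@cstar_mulA R A)
    (@cstar_mul1l R A) (@cstar_mul1r R A) (@cstar_mulDl R A)
    (@cstar_mulDr R A).

Definition star (R : realType) (A : unitalCStarType R) : A -> A :=
  @cstar_star R A.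

Section CStarAlgebras.
Context {R : realType}.

Definition is_projection (A : unitalCStarType R) (p : A) : Prop :=
  p * p = p /\ star p = p.

Definition is_star_automorphism (A : unitalCStarType R) (f : A -> A) : Prop :=
  [/\ linear f, {morph f : x y / x * y}, {morph f : x / star x}
    & bijective f].

(* A group homomorphism from [gT] to Aut(A). *)
Definition is_cstar_action (gT : finGroupType) (A : unitalCStarType R)
    (alpha : gT -> A -> A) : Prop :=
  (forall g, is_star_automorphism (alpha g)) /\
  (forall g h a, alpha (g * h)%g a = alpha g (alpha h a)).

Definition is_span (V : lmodType R[i]) (S : set V) (n : nat) (v : 'I_n -> V)
    : Prop :=
  S = [set x | exists c : 'I_n -> R[i], x = \sum_(i < n) c i *: v i].

(* Such a set is automatically norm closed; it need not contain the unit
   of [A]. *)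
Definition is_findim_cstar_subalgebra (A : unitalCStarType R) (S : set A)
    : Prop :=
  [/\ exists n (v : 'I_n -> A), is_span S v,
      forall x y, S x -> S y -> S (x * y)
    & forall x, S x -> S (star x)].

(* The chain is indexed by [nat], hence these algebras are separable. *)
Definition is_AF (A : unitalCStarType R) : Prop :=
  exists S : nat -> set A,
    [/\ forall n, is_findim_cstar_subalgebra (S n),
        forall n, S n `<=` S n.+1
      & dense (\bigcup_n S n)].

Definition strict_Rokhlin (gT : finGroupType) (A : unitalCStarType R)
    (alpha : gT -> A -> A) : Prop :=
  forall (F : set A) (eps : R[i]), finite_set F -> 0 < eps ->
  exists e : gT -> A,
    [/\ (forall g, is_projection (e g)) /\
        (forall g h, g <> h -> e g * e h = 0),
        forall g h, `|alpha g (e h) - e (g * h)%g| < eps,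
        forall g a, F a -> `|e g * a - a * e g| < eps
      & \sum_(g : gT) e g = 1].

End CStarAlgebras.

Record hilbertSpace (R : realType) := HilbertSpace {
  hilbert_sort :> completeNormedModType R[i];
  inner : {dot hilbert_sort for (@Num.conj R[i])};
  norm_inner : forall x : hilbert_sort, `|x| ^+ 2 = inner x x
}.
Arguments inner {R h}.

Section CrossedProduct.
Context {R : realType} (gT : finGroupType) (A : unitalCStarType R).
Variable alpha : gT -> A -> A.

Definition convolution (f k : {ffun gT -> A}) : {ffun gT -> A} :=
  [ffun s => \sum_(t : gT) f t * alpha t (k (t^-1 * s)%g)].

Definition convolution_star (f : {ffun gT -> A}) : {ffun gT -> A} :=
  [ffun s => alpha s (star (f (s^-1)%g))].

(* Not required to be nondegenerate. *)
Definition is_representation (H : hilbertSpace R) (pi : A -> H -> H) : Prop :=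
  [/\ forall a, linear (pi a) /\ continuous (pi a),
      forall (c : R[i]) a b x, pi (c *: a + b) x = c *: pi a x + pi b x,
      forall a b x, pi (a * b) x = pi a (pi b x)
    & forall a x y, inner (pi a x) y = inner x (pi (star a) y)].

Definition is_unitary_representation (H : hilbertSpace R) (v : gT -> H -> H)
    : Prop :=
  [/\ forall g, linear (v g) /\ bijective (v g),
      forall g x y, inner (v g x) (v g y) = inner x y
    & forall g h x, v (g * h)%g x = v g (v h x)].

Definition is_covariant (H : hilbertSpace R) (pi : A -> H -> H)
    (v : gT -> H -> H) : Prop :=
  [/\ is_representation pi, is_unitary_representation v
    & forall g a x, v g (pi a x) = pi (alpha g a) (v g x)].

Definition integrated_form (H : hilbertSpace R) (pi : A -> H -> H)
    (v : gT -> H -> H) (f : {ffun gT -> A}) (x : H) : H :=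
  \sum_(g : gT) pi (f g) (v g x).

Definition universal_norm_bound (f : {ffun gT -> A}) (M : R[i]) : Prop :=
  0 <= M /\
  forall (H : hilbertSpace R) (pi : A -> H -> H) (v : gT -> H -> H),
    is_covariant pi v ->
    forall x, `|integrated_form pi v f x| <= M * `|x|.

(* [M] is the supremum of the operator norms of the integrated forms of [f]
   over all covariant representations. *)
Definition is_universal_norm (f : {ffun gT -> A}) (M : R[i]) : Prop :=
  universal_norm_bound f M /\
  forall M', universal_norm_bound f M' -> M <= M'.

(* [B], together with [iota], is the completion of the *-algebra of functions
   from [gT] to [A], under convolution, in the universal norm. *)
Definition is_crossed_product (B : unitalCStarType R)
    (iota : {ffun gT -> A} -> B) : Prop :=
  [/\ linear iota,
      forall f k, iota (convolution f k) = iota f * iota k,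
      forall f, iota (convolution_star f) = star (iota f),
      forall f, is_universal_norm f `|iota f|
    & dense (range iota)].

End CrossedProduct.

(* Main.v *)
From Stdlib Require Ncring Ncring_tac.
Require Import Defs.
From mathcomp Require Import all_boot all_order all_fingroup all_algebra.
From mathcomp Require Import complex.
From mathcomp Require Import all_classical all_reals all_analysis.
From mathcomp Require Import ring lra.

(** Why the crossed product is AF.  Let [u g] be the canonical unitaries of [B]
and view [A] inside [B].  Rokhlin projections [e g] that are almost permuted
by the action make the elements [u g * e 1] behave like the first column of a
system of matrix units indexed by the group, with [e 1] almost commuting with
any prescribed finite part of [A].  An element [a] is then close to the sum of
the [u g * e 1 * alpha g^-1 a * e 1 * star (u g)], and [u h] is close to the
sum of the [u (h * g) * e 1 * star (u g)]; so everything is approximated inside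
matrices over the corner of [A] at [e 1].  To stay finite-dimensional, [e 1] is
replaced by a nearby projection [q] of a finite-dimensional *-subalgebra [S]
of [A] ([near_projection]), and [e g * u g * q] by its polar part [v g]
([partial_isometry]), a partial isometry with [star (v g) * v h] equal to [q]
or [0].  The sums of the [v g * X g h * star (v h)] with [X g h] in [S] form a
finite-dimensional *-subalgebra of [B] ([corner_algebra]).  Hence every finite
subset of [B] is almost contained in a finite-dimensional *-subalgebra
([local_generators], [crossed_product_locally_findim]).

That local property yields an increasing chain by Bratteli's perturbation
argument ([locally_findim_extend]): if a finite-dimensional [S] is almost
contained in a finite-dimensional [T], then a unitary close to [1] conjugates
[S] into [T] ([near_inclusion]).  It is proved without classifying
finite-dimensional C*-algebras.  The trace form of the regular representation
of [S] is nondegenerate, because an element of its radical would produce a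
nonzero self-adjoint nilpotent element, and a pair of dual bases gives a
separability idempotent, the sum of the [a i (x) b i] ([findim_diagonal]).
With [t i] in [T] close to [a i], averaging [W] to the sum of the
[t i * W * b i] turns an error [d] in the relations [W * a i = t i * W] into an
error of order [d ^ 2] ([newton_step]), so a Newton iteration converges to an
invertible [W] near [1] that conjugates [S] into [T] ([intertwiner]);
averaging [star W * W] and taking polar parts makes it unitary.

All the analysis rests on one convergence principle ([geometric_iteration]),
which also gives inverse square roots near [1] ([inv_sqrt]), hence projections,
partial isometries and inverses, without spectral theory; and on the fact
that finite-dimensional subspaces are closed ([span_nclosed]), which keeps the
limits inside the algebras where the approximants live. *)

Set Implicit Arguments.
Unset Strict Implicit.
Unset Printing Implicit Defensive.

Import Order.TTheory GRing.Theory Num.Theory.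
Import numFieldNormedType.Exports.

Local Open Scope classical_set_scope.
Local Open Scope ring_scope.
Local Open Scope complex_scope.

(** * Norms with real values *)

Section RealNorm.
Context {R : realType} {V : normedModType R[i]}.
Implicit Types (x y : V) (c : R[i]).

(** The norm takes values in [R[i]], whose order is partial; this real-valued
version carries all the estimates. *)
Definition nrm x : R := complex.Re `|x|.

Lemma nrmE x : `|x| = (nrm x)%:C.
Proof. by rewrite /nrm RRe_real ?normr_real. Qed.

Lemma nrm_ge0 x : 0 <= nrm x.
Proof. by rewrite -ler0c -nrmE normr_ge0. Qed.

Lemma nrm0 : nrm (0 : V) = 0.
Proof. by rewrite /nrm normr0. Qed.

Lemma nrm_eq0 x : nrm x = 0 -> x = 0.
Proof. by move=> h; apply/eqP; rewrite -normr_eq0 nrmE h. Qed.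

Lemma nrmD x y : nrm (x + y) <= nrm x + nrm y.
Proof. by rewrite -lecR rmorphD /= -!nrmE ler_normD. Qed.

Lemma nrmN x : nrm (- x) = nrm x.
Proof. by rewrite /nrm normrN. Qed.

Lemma nrmB x y : nrm (x - y) = nrm (y - x).
Proof. by rewrite -nrmN opprB. Qed.

Lemma nrm_tri z x y : nrm (x - y) <= nrm (x - z) + nrm (z - y).
Proof. by rewrite -{1}(subrK z x) -addrA nrmD. Qed.

Lemma nrmZ c x : nrm (c *: x) = complex.Re `|c| * nrm x.
Proof.
by apply: complexI; rewrite rmorphM /= -!nrmE normrZ; congr (_ * _).
Qed.

Lemma nrmZr (t : R) x : nrm (t%:C *: x) = `|t| * nrm x.
Proof. by rewrite nrmZ normc_def /= expr0n addr0 sqrtr_sqr. Qed.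

Lemma nrm_sum (I : Type) (r : seq I) (P : pred I) (F : I -> V) :
  nrm (\sum_(i <- r | P i) F i) <= \sum_(i <- r | P i) nrm (F i).
Proof.
elim/big_rec2: _ => [|i a b _ h]; first by rewrite nrm0.
by apply: le_trans (nrmD _ _) _; rewrite lerD2l.
Qed.

Lemma nrm_small x : (forall e : R, 0 < e -> nrm x < e) -> x = 0.
Proof.
move=> h; apply: nrm_eq0; apply: le_anti; rewrite nrm_ge0 andbT.
by case: leP => // /h; rewrite ltxx.
Qed.

Lemma nrm_lt x (e : R) : (`|x| < e%:C) = (nrm x < e).
Proof. by rewrite nrmE ltcR. Qed.

Lemma gt0_real c : 0 < c -> exists2 e : R, 0 < e & c = e%:C.
Proof.
by case: c => a b; rewrite ltcE /= => /andP[/eqP-> h]; exists a.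
Qed.

Lemma denseP (S : set V) :
  dense S <-> forall x (e : R), 0 < e -> exists2 y, S y & nrm (x - y) < e.
Proof.
split=> [dS x e e0|H O [x Ox] Oo].
  have e0C : 0 < e%:C by rewrite ltcR.
  have [||y [/= Oy Sy]] := dS (ball x e%:C).
  - by exists x; apply: ballxx.
  - exact: ball_open.
  exists y => //; move: Oy.
  by rewrite -ball_normE /ball_ /= nrm_lt.
have /nbhs_ballP[_/posnumP[e] sub] := open_nbhs_nbhs (conj Oo Ox).
have [e' e'0 e'E] := gt0_real (gt0 e).
have [y Sy xy] := H x e' e'0.
exists y; split => //; apply: sub.
by rewrite -ball_normE /ball_ /= e'E nrm_lt.
Qed.

(** Closedness phrased with the real norm: it is applied to predicates, such as
commutation relations, as well as to subspaces. *)
Definition nclosed (P : V -> Prop) :=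
  forall x, (forall e : R, 0 < e -> exists2 y, P y & nrm (x - y) < e) -> P x.

End RealNorm.

(** * Limits of geometric approximation schemes *)

Section Complete.
Context {R : realType} {V : completeNormedModType R[i]}.

Lemma nrm_cauchy_lim (u : nat -> V) :
  (forall e : R, 0 < e -> exists N, forall m, (N <= m)%N -> nrm (u N - u m) < e) ->
  exists l, forall e : R, 0 < e -> exists N, forall m, (N <= m)%N -> nrm (l - u m) < e.
Proof.
move=> cu; have : cvg (u @ \oo).
  apply/cauchy_cvgP/cauchy_exP => _/posnumP[e].
  have [e' e'0 e'E] := gt0_real (gt0 e).
  have [N HN] := cu e' e'0.
  exists (u N); exists N => // m /= Nm.
  by rewrite -ball_normE /ball_ /= e'E nrm_lt HN.
move=> cvu; exists (lim (u @ \oo)) => e e0.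
have /cvgrPdist_lt /(_ e%:C) := cvu.
rewrite ltcR => /(_ e0) [N _ HN].
by exists N => m Nm; rewrite -nrm_lt; apply: HN.
Qed.

Lemma div_pow2_small (d e : R) : 0 <= d -> 0 < e ->
  exists n, forall m, (n <= m)%N -> d / 2 ^+ m < e.
Proof.
move=> d0 e0; exists (Num.bound (d / e)) => m nm.
have Hn : d / e < (Num.bound (d / e))%:R by apply: archi_boundP; rewrite divr_ge0 // ltW.
rewrite ltr_pdivrMr ?exprn_gt0 //.
rewrite ltr_pdivrMr // in Hn; rewrite mulrC; apply: lt_le_trans Hn _.
rewrite ler_pM2r // -natrX ler_nat; apply: leq_trans nm _.
exact: ltnW (ltn_expl _ _).
Qed.
(** The common shape of the Newton schemes: a step moves [x] by at most [C * d]
and halves the error [d], so that the total displacement is at most the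
geometric series [C * d0 * (1 + 1/2 + ...) = 2 * C * d0].  The step may
therefore assume that [x] is still that close to [x0]. *)
Lemma geometric_iteration (P : V -> R -> Prop) (C d0 : R) (x0 : V) :
  0 <= C -> 0 < d0 -> P x0 d0 ->
  (forall x d, 0 < d -> d <= d0 -> nrm (x - x0) <= 2 * C * d0 -> P x d ->
    exists2 y, nrm (y - x) <= C * d & P y (d / 2)) ->
  exists2 l, nrm (l - x0) <= 2 * C * d0 &
    forall e, 0 < e -> exists x d, [/\ nrm (l - x) < e, 0 < d, d < e & P x d].
Proof.
move=> C0 d00 P0 step.
(* The invariant keeps the exact remaining budget, so that all iterates stay in
   the ball where the step applies. *)
pose dd n : R := d0 / 2 ^+ n.
have dd0 n : 0 < dd n by rewrite divr_gt0 // exprn_gt0.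
have ddS n : dd n.+1 = dd n / 2 by rewrite /dd exprS; field.
have ddle n : dd n <= d0.
  elim: n => [|n IH]; first by rewrite /dd expr0 divr1.
  by rewrite ddS; have := dd0 n; lra.
pose Q n x := P x (dd n) /\ nrm (x - x0) <= 2 * C * (d0 - dd n).
have stepQ n x : exists y, Q n x -> Q n.+1 y /\ nrm (y - x) <= C * dd n.
  have [[Px xx0]|nQ] := pselect (Q n x); last by exists x.
  have Cdd : 0 <= C * dd n by rewrite mulr_ge0 // ltW.
  have xx0' : nrm (x - x0) <= 2 * C * d0 by apply: le_trans xx0 _; nra.
  have [y yx Py] := step x (dd n) (dd0 n) (ddle n) xx0' Px.
  exists y => _; split => //; split; first by rewrite ddS.
  have := nrm_tri x y x0; rewrite ddS.
  have : 2 * C * (d0 - dd n / 2) = 2 * C * (d0 - dd n) + C * dd n by field.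
  lra.
pose nxt n x := projT1 (cid (stepQ n x)).
have nxtP n x : Q n x -> Q n.+1 (nxt n x) /\ nrm (nxt n x - x) <= C * dd n.
  by rewrite /nxt; case: cid.
pose u := fix u n := if n is m.+1 then nxt m (u m) else x0.
have uQ n : Q n (u n).
  elim: n => [|n IH]; last by have [] := nxtP _ _ IH.
  by rewrite /Q /dd expr0 divr1 subrr nrm0 subrr mulr0 /=.
have uS n : nrm (u n.+1 - u n) <= C * dd n by have [] := nxtP _ _ (uQ n).
have uD n k : nrm (u (n + k)%N - u n) <= 2 * C * (dd n - dd (n + k)%N).
  elim: k => [|k IH]; first by rewrite addn0 !subrr nrm0 mulr0.
  have := nrm_tri (u (n + k)%N) (u (n + k.+1)%N) (u n).
  have := uS (n + k)%N; rewrite addnS ddS.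
  have : 2 * C * (dd n - dd (n + k)%N / 2) =
    2 * C * (dd n - dd (n + k)%N) + C * dd (n + k)%N by field.
  lra.
have uD' n m : (n <= m)%N -> nrm (u n - u m) <= 2 * C * dd n.
  move=> /subnKC <-; rewrite nrmB; apply: le_trans (uD _ _) _.
  by have := mulr_ge0 C0 (ltW (dd0 (n + (m - n))%N)); nra.
have ddlim e : 0 < e -> exists n, forall m, (n <= m)%N -> dd m < e.
  by apply: div_pow2_small; exact: ltW.
have [|l Hl] := @nrm_cauchy_lim u.
  move=> e e0; have D0 : 0 < 2 * C + 1 by lra.
  have [n Hn] := ddlim (e / (2 * C + 1)) (divr_gt0 e0 D0).
  exists n => m nm; apply: le_lt_trans (uD' _ _ nm) _.
  have := Hn n (leqnn _); rewrite ltr_pdivlMr //.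
  by have := dd0 n; lra.
exists l.
  apply/ler_addgt0Pr => e e0; have [N HN] := Hl e e0.
  have := nrm_tri (u N) l x0; have := HN N (leqnn _).
  have := (uQ N).2; have := mulr_ge0 C0 (ltW (dd0 N)); nra.
move=> e e0; have [N1 HN1] := Hl e e0; have [N2 HN2] := ddlim e e0.
exists (u (maxn N1 N2)), (dd (maxn N1 N2)); split => //.
- by apply: HN1; rewrite leq_maxl.
- by apply: HN2; rewrite leq_maxr.
- by have [] := uQ (maxn N1 N2).
Qed.

End Complete.

(** These instances let the decision procedure for noncommutative ring identities
run on every ring. *)
(** * C*-norms and inverse square roots near the unit *)

#[local] Instance pzRing_Ncring_ops (S : pzRingType) :
  @Ncring.Ring_ops S 0 1 +%R *%R (fun x y => x - y) -%R eq := {}.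
#[local] Instance pzRing_Ncring (S : pzRingType) : Ncring.Ring (Ro := pzRing_Ncring_ops S).
Proof.
split=> //; try by move=> x y -> // u v ->.
- exact: RelationClasses.eq_equivalence.
- exact: add0r.
- exact: addrC.
- exact: addrA.
- exact: mul1r.
- exact: mulr1.
- exact: mulrA.
- exact: mulrDl.
- by move=> x y z; apply: mulrDr.
- exact: subrr.
Qed.
Ltac ncring := Ncring_tac.non_commutative_ring.

Section Star.
Context {R : realType} {A : unitalCStarType R}.
Implicit Types (x y : A) (c : R[i]).

Lemma starD x y : star (x + y) = star x + star y.
Proof. exact: cstar_starD. Qed.
Lemma starM x y : star (x * y) = star y * star x.
Proof. exact: cstar_starM. Qed.
Lemma starK x : star (star x) = x.
Proof. exact: cstar_starK. Qed.
Lemma starZ c x : star (c *: x) = c^* *: star x.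
Proof. exact: cstar_starZ. Qed.
Lemma scaleAl c x y : (c *: x) * y = c *: (x * y).
Proof. exact: cstar_mulZl. Qed.
Lemma scaleAr c x y : x * (c *: y) = c *: (x * y).
Proof. exact: cstar_mulZr. Qed.
Lemma star0 : star (0 : A) = 0.
Proof. by apply: (addrI (star 0)); rewrite -starD !addr0. Qed.
Lemma starN x : star (- x) = - star x.
Proof. by apply: (addrI (star x)); rewrite -starD !subrr star0. Qed.
Lemma starB x y : star (x - y) = star x - star y.
Proof. by rewrite starD starN. Qed.
Lemma star1 : star (1 : A) = 1.
Proof. by rewrite -[LHS]mulr1 -{2}(starK 1) -starM mulr1 starK. Qed.
Lemma star_sum (I : Type) (r : seq I) (P : pred I) (F : I -> A) :
  star (\sum_(i <- r | P i) F i) = \sum_(i <- r | P i) star (F i).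
Proof.
by elim/big_rec2: _ => [|i a b _ <-]; rewrite ?star0 ?starD.
Qed.

Lemma nrmM x y : nrm (x * y) <= nrm x * nrm y.
Proof. rewrite -lecR rmorphM /= -!nrmE; exact: cstar_normM. Qed.

Lemma nrm_cstar x : nrm (star x * x) = nrm x ^+ 2.
Proof. by apply: complexI; rewrite rmorphXn /= -!nrmE; apply: cstar_identity. Qed.

(** From the C*-identity, [nrm x ^+ 2 <= nrm (star x) * nrm x]; cancel one factor
and apply the result to [star x] as well. *)
Lemma nrm_star x : nrm (star x) = nrm x.
Proof.
suff H y : nrm y <= nrm (star y).
  by apply: le_anti; rewrite H -{2}(starK x) H.
have := nrmM (star y) y; rewrite nrm_cstar expr2.
have := nrm_ge0 y; rewrite le_eqVlt => /orP[/eqP <- _|y0].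
  exact: nrm_ge0.
by rewrite ler_pM2r.
Qed.

Lemma nrm_sq_le1 x : nrm x ^+ 2 <= nrm x -> nrm x <= 1.
Proof. by have := nrm_ge0 x; nra. Qed.

Lemma nrm1 : nrm (1 : A) <= 1.
Proof. by apply: nrm_sq_le1; rewrite -nrm_cstar star1 mulr1. Qed.

Lemma nrm_proj x : star x = x -> x * x = x -> nrm x <= 1.
Proof. by move=> s p; apply: nrm_sq_le1; rewrite -nrm_cstar s p. Qed.

Lemma nrm_isom x : nrm (star x * x) <= 1 -> nrm x <= 1.
Proof. by rewrite nrm_cstar; have := nrm_ge0 x; nra. Qed.

Lemma nclosedP (P : A -> Prop) (f : A -> A) (K : R) :
  (forall x y, nrm (f x - f y) <= K * nrm (x - y)) ->
  nclosed P -> nclosed (fun x => P (f x)).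
Proof.
move=> fK cP x H; apply: cP => e e0.
have K0 : 0 < `|K| + 1 by have := normr_ge0 K; lra.
have [y Py xy] := H (e / (`|K| + 1)) (divr_gt0 e0 K0).
exists (f y) => //; apply: le_lt_trans (fK x y) _.
move: xy; rewrite ltr_pdivlMr // => xy.
have := nrm_ge0 (x - y); have := ler_norm K; nra.
Qed.

Lemma nclosed0 : nclosed (fun x : A => x = 0).
Proof.
move=> x H; apply: nrm_small => e e0.
by have [y -> ] := H e e0; rewrite subr0.
Qed.

Lemma nclosed_comm (a : A) : nclosed (fun x => a * x = x * a).
Proof.
move=> x H; apply: subr0_eq.
have K : forall y z, nrm ((a * y - y * a) - (a * z - z * a)) <= (2 * nrm a) * nrm (y - z).
  move=> y z; have -> : (a * y - y * a) - (a * z - z * a) = a * (y - z) - (y - z) * a by ncring.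
  apply: le_trans (nrmD _ _) _; rewrite nrmN.
  by have := nrmM a (y - z); have := nrmM (y - z) a; nra.
apply: (@nclosedP (fun x => x = 0) (fun x => a * x - x * a) _ K nclosed0) => e e0.
by have [y yP xy] := H e e0; exists y => //; rewrite yP subrr.
Qed.

Lemma nclosed_sa : nclosed (fun x : A => star x = x).
Proof.
move=> x H; apply: subr0_eq.
have K : forall y z : A, nrm ((star y - y) - (star z - z)) <= 2 * nrm (y - z).
  move=> y z; have -> : (star y - y) - (star z - z) = star (y - z) - (y - z).
    by rewrite starB; ncring.
  by apply: le_trans (nrmD _ _) _; rewrite nrmN nrm_star; lra.
apply: (@nclosedP (fun x => x = 0) (fun x => star x - x) _ K nclosed0) => e e0.
by have [y yP xy] := H e e0; exists y => //; rewrite yP subrr.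
Qed.

Definition halfC : R[i] := (2^-1)%:C.

Lemma half2 (x : A) : halfC *: x + halfC *: x = x.
Proof.
rewrite -scalerDl /halfC -rmorphD /=.
have -> : 2^-1 + 2^-1 = 1 :> R by field.
by rewrite rmorph1 scale1r.
Qed.

Lemma nrm_half (x : A) : nrm (halfC *: x) = nrm x / 2.
Proof. by rewrite nrmZr ger0_norm ?invr_ge0 // mulrC. Qed.

Lemma star_half (x : A) : star (halfC *: x) = halfC *: star x.
Proof. by rewrite starZ; congr (_ *: _); apply: conjc_real. Qed.

(** Newton's method for [r * r * (1 + h) = 1]: with [E := 1 - r * r * (1 + h)], the
iterate [r + r * E / 2] has error [3/4 * E ^+ 2 + 1/4 * E ^+ 3].  Closed
properties preserved by the iteration pass to the limit, which is how
self-adjointness, commutation and membership in a subalgebra are obtained. *)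
Lemma inv_sqrt (h : A) (d : R) : 0 < d -> d <= 1/4 -> nrm h <= d ->
  exists r : A, [/\ r * r * (1 + h) = 1, nrm (r - 1) <= 2 * d &
    forall P : A -> Prop, nclosed P -> P 1 ->
      (forall x, P x -> P (x + halfC *: (x * (1 - x * x * (1 + h))))) -> P r].
Proof.
move=> d0 d4 hd.
pose F x : A := x + halfC *: (x * (1 - x * x * (1 + h))).
pose Q x := forall P : A -> Prop, P 1 -> (forall x, P x -> P (F x)) -> P x.
have Qc x : Q x -> h * x = x * h.
  move/(_ (fun x => h * x = x * h)); apply; first by rewrite mulr1 mul1r.
  move=> {}x hx; rewrite /F mulrDr mulrDl scaleAl scaleAr; congr (_ + _ *: _) => //.
  rewrite !mulrA hx -!(mulrA x); congr (_ * _).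
  have -> : h * (1 - x * (x * (1 + h))) = h - (h * x) * x * (1 + h) by ncring.
  by rewrite hx -(mulrA x h) hx; ncring.
pose P x e := Q x /\ nrm (1 - x * x * (1 + h)) <= e.
have [||r r1 rlim] := @geometric_iteration R A P 1 d 1 ler01 d0.
- by split=> //; (have -> : 1 - 1 * 1 * (1 + h) = - h by ncring); rewrite nrmN.
- move=> x e e0 ed xd [Qx xe]; set E := 1 - _ in xe.
  have Ex : E * x = x * E.
    have hx := Qc _ Qx.
    have -> : E * x = x - x * x * x - x * x * (h * x) by rewrite /E; ncring.
    by rewrite hx /E; ncring.
  have x2 : nrm x <= 2.
    by have := nrm_tri (1 : A) x 0; rewrite !subr0; have := nrm1; lra.
  exists (F x).
    have -> : F x - x = halfC *: (x * E) by rewrite /F /E addrC addKr.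
    rewrite nrm_half; have := nrmM x E; have := nrm_ge0 E; have := nrm_ge0 x; nra.
  split; first by move=> P' P1 PF; apply: (PF); apply: Qx.
  pose e' := halfC *: E.
  have EE : E = e' + e' by rewrite half2.
  have FE : F x = x * (1 + e') by rewrite /F -/E -scaleAr -/e'; ncring.
  have e'x : e' * x = x * e' by rewrite scaleAl scaleAr Ex.
  have xxh : x * x * (1 + h) = 1 - E by rewrite /E; ncring.
  have -> : 1 - F x * F x * (1 + h) = (e' * e') * (1+1+1) + (e' * e' * e') * (1+1).
    have -> : F x * F x * (1 + h) = (1 + e') * (1 + e') * (x * x * (1 + h)).
      have c : (1 + e') * x = x * (1 + e') by rewrite mulrDl e'x; ncring.
      by rewrite FE -c !mulrA; congr (_ * _); rewrite -!mulrA; congr (_ * _); rewrite !mulrA -c.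
    by rewrite xxh EE; ncring.
  have e'n : nrm e' <= e / 2 by rewrite nrm_half; lra.
  have e'0 := nrm_ge0 e'.
  have A1 : nrm (e' * e') <= nrm e' * nrm e' := nrmM _ _.
  have A2 : nrm (e' * e' * e') <= nrm e' * nrm e' * nrm e'.
    by apply: le_trans (nrmM _ _) _; rewrite ler_wpM2r.
  have -> : (e' * e') * (1+1+1) + (e' * e' * e') * (1+1) =
    e' * e' + e' * e' + e' * e' + e' * e' * e' + e' * e' * e' by ncring.
  have t4 := nrmD (e' * e' + e' * e' + e' * e' + e' * e' * e') (e' * e' * e').
  have t3 := nrmD (e' * e' + e' * e' + e' * e') (e' * e' * e').
  have t2 := nrmD (e' * e' + e' * e') (e' * e').
  have t1 := nrmD (e' * e') (e' * e').
  have p8 : nrm e' <= 1 / 8 by lra.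
  have p2 : nrm e' * nrm e' <= 1 / 8 * nrm e' by rewrite ler_wpM2r.
  have p3 : nrm e' * nrm e' * nrm e' <= 1 / 8 * nrm e' * (1 / 8).
    by apply: ler_pM => //; rewrite mulr_ge0.
  lra.
- exists r; split; last 1 first.
  + move=> P' cP' P1 PF; apply: (cP' r) => e e0.
    have [x [e' [rx _ _ [Qx _]]]] := rlim e e0.
    by exists x => //; apply: Qx.
  + apply/esym; apply: subr0_eq; apply: nrm_small => e e0.
    have [x [e' [rx e'0 e'e [_ xE]]]] := rlim (Num.min (e / 20) 1) ltac:(rewrite lt_min; apply/andP; split; lra).
    move: rx e'e; rewrite !lt_min => /andP[rx rx1] /andP[e'e _].
    have r2 : nrm r <= 2.
      by have := nrm_tri (1 : A) r 0; rewrite !subr0; have := nrm1; lra.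
    have x2 : nrm x <= nrm r + nrm (r - x).
      by have := nrm_tri r x 0; rewrite !subr0 (nrmB x); lra.
    have h2 : nrm (1 + h) <= 2 by have := nrmD (1 : A) h; have := nrm1; lra.
    have -> : 1 - r * r * (1 + h) =
      (1 - x * x * (1 + h)) - (r * (r - x) + (r - x) * x) * (1 + h) by ncring.
    have t1 := nrmD (1 - x * x * (1 + h)) (- ((r * (r - x) + (r - x) * x) * (1 + h))).
    rewrite nrmN in t1.
    have t2 := nrmM (r * (r - x) + (r - x) * x) (1 + h).
    have t3 := nrmD (r * (r - x)) ((r - x) * x).
    have t4 := nrmM r (r - x); have t5 := nrmM (r - x) x.
    have D0 := nrm_ge0 (r - x).
    have t6 : nrm r * nrm (r - x) <= 2 * nrm (r - x) by rewrite ler_wpM2r.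
    have t7 : nrm (r - x) * nrm x <= nrm (r - x) * 3 by rewrite ler_wpM2l //; lra.
    have t8 : nrm (r * (r - x) + (r - x) * x) * nrm (1 + h) <= 5 * nrm (r - x) * 2.
      by apply: ler_pM => //; [exact: nrm_ge0 | exact: nrm_ge0 | lra].
    lra.
  + by rewrite mulr1 in r1.
Qed.
End Star.

(** * Finite-dimensional subspaces are closed *)

Section ComplexComplete.
Context {R : realType}.

Lemma real_cauchy_lim (u : nat -> R) :
  (forall e : R, 0 < e -> exists N, forall m, (N <= m)%N -> `|u N - u m| < e) ->
  exists l, forall e : R, 0 < e -> exists N, forall m, (N <= m)%N -> `|l - u m| < e.
Proof.
move=> cu; have : cvg (u @ \oo).
  apply/cauchy_cvgP/cauchy_exP => e e0; have [N HN] := cu e e0.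
  exists (u N); exists N => // m /= Nm; exact: HN.
move=> cvu; exists (lim (u @ \oo)) => e e0.
have /cvgrPdist_lt /(_ e e0) [N _ HN] := cvu.
by exists N => m Nm; apply: HN.
Qed.

Definition cabs (z : R[i]) : R := complex.Re `|z|.

Lemma cabs_Re z : `|complex.Re z| <= cabs z.
Proof. by have := normc_ge_Re z; rewrite lecE /cabs => /andP[]. Qed.

Lemma cabs_Im z : `|complex.Im z| <= cabs z.
Proof.
rewrite /cabs normc_def /= -sqrtr_sqr ler_wsqrtr // lerDr sqr_ge0 //.
Qed.

Lemma cabs_le z : cabs z <= `|complex.Re z| + `|complex.Im z|.
Proof.
rewrite /cabs normc_def /= -(ger0_norm (addr_ge0 (normr_ge0 (complex.Re z)) (normr_ge0 (complex.Im z)))).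
rewrite -sqrtr_sqr ler_wsqrtr // sqrrD !real_normK ?num_real //.
by have := mulr_ge0 (normr_ge0 (complex.Re z)) (normr_ge0 (complex.Im z)); lra.
Qed.

Lemma cabs_ge0 z : 0 <= cabs z.
Proof. exact: le_trans (normr_ge0 _) (cabs_Re z). Qed.

Lemma complex_cauchy_lim (c : nat -> R[i]) :
  (forall e : R, 0 < e -> exists N, forall m, (N <= m)%N -> cabs (c N - c m) < e) ->
  exists l, forall e : R, 0 < e -> exists N, forall m, (N <= m)%N -> cabs (l - c m) < e.
Proof.
move=> cc.
have ReB (x y : R[i]) : complex.Re (x - y) = complex.Re x - complex.Re y.
  by case: x y => [? ?] [? ?].
have ImB (x y : R[i]) : complex.Im (x - y) = complex.Im x - complex.Im y.
  by case: x y => [? ?] [? ?].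
have [|a Ha] := @real_cauchy_lim (fun n => complex.Re (c n)).
  move=> e /cc[N HN]; exists N => m /HN; apply: le_lt_trans.
  by rewrite -ReB cabs_Re.
have [|b Hb] := @real_cauchy_lim (fun n => complex.Im (c n)).
  move=> e /cc[N HN]; exists N => m /HN; apply: le_lt_trans.
  by rewrite -ImB cabs_Im.
exists (a +i* b) => e e0.
have [N1 H1] := Ha (e / 2) ltac:(lra); have [N2 H2] := Hb (e / 2) ltac:(lra).
exists (maxn N1 N2) => m; rewrite geq_max => /andP[/H1 h1 /H2 h2].
by apply: le_lt_trans (cabs_le _) _; rewrite ReB ImB /=; lra.
Qed.
End ComplexComplete.

Section SpanClosed.
Context {R : realType} {V : completeNormedModType R[i]}.

(** By induction on the number of generators.  A new generator [v0] outside the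
closed subspace already built has a positive distance [d] to it, so that the
coefficient of [v0] is bounded by the norm divided by [d]; along a convergent
sequence these coefficients form a Cauchy sequence in [R[i]]. *)
Lemma span_nclosed n (v : 'I_n -> V) :
  nclosed (fun x => exists c : 'I_n -> R[i], x = \sum_(i < n) c i *: v i).
Proof.
elim: n v => [|n IH] v.
  move=> x H; exists (fun=> 0); rewrite big_ord0; apply: nrm_small => e e0.
  by have [y [c ->]] := H e e0; rewrite big_ord0 subr0.
pose w i := v (widen_ord (leqnSn n) i); pose v0 := v ord_max.
pose P x := exists c : 'I_n -> R[i], x = \sum_(i < n) c i *: w i.
have PB x y : P x -> P y -> P (x - y).
  move=> [c ->] [d ->]; exists (fun i => c i - d i).
  by rewrite -sumrB; apply: eq_bigr => i _; rewrite scalerBl.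
have PZ a x : P x -> P (a *: x).
  move=> [c ->]; exists (fun i => a * c i).
  by rewrite scaler_sumr; apply: eq_bigr => i _; rewrite scalerA.
have PD x y : P x -> P y -> P (x + y).
  move=> Px Py; have -> : x + y = x - (-1) *: y by rewrite scaleN1r opprK.
  exact/PB/PZ.
have cP : nclosed P := IH w.
have spanE x : (exists c : 'I_n.+1 -> R[i], x = \sum_i c i *: v i) <->
    exists a, P (x - a *: v0).
  split=> [[c ->]|[a [c xc]]].
    exists (c ord_max); rewrite big_ord_recr /= addrK.
    by exists (fun i => c (widen_ord (leqnSn n) i)).
  exists (fun i => if unlift ord_max i is Some j then c j else a).
  rewrite big_ord_recr /= unlift_none -[LHS](subrK (a *: v0)) xc.
  congr (_ + _); apply: eq_bigr => i _.
  have -> : widen_ord (leqnSn n) i = lift ord_max i by apply: ord_inj; rewrite lift_max.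
  by rewrite liftK /w; congr (_ *: v _); apply: ord_inj; rewrite lift_max.
move=> x H; apply/spanE.
have {}H e : 0 < e -> exists a y, P y /\ nrm (x - (y + a *: v0)) < e.
  move=> /H[y /spanE[a Pa] xy]; exists a, (y - a *: v0); split => //.
  by rewrite subrK.
have [Pv|nPv] := pselect (P v0).
  exists 0; rewrite scale0r subr0; apply: cP => e /H[a [y [Py xy]]].
  by exists (y + a *: v0) => //; apply: PD => //; apply: PZ.
have [d d0 dP] : exists2 d, 0 < d & forall y, P y -> d <= nrm (v0 - y).
  apply: contrapT => nd; apply: nPv; apply: cP => e e0.
  apply: contrapT => ne; apply: nd; exists e => // y Py.
  by rewrite leNgt; apply/negP => lt; apply: ne; exists y.
have dPa a y : P y -> cabs a * d <= nrm (y + a *: v0).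
  move=> Py; have [->|a0] := eqVneq a 0.
    by rewrite /cabs normr0 /= mul0r nrm_ge0.
  have -> : y + a *: v0 = a *: (v0 - (- a^-1) *: y).
    by rewrite scalerBr scalerA mulrN divff // scaleN1r opprK addrC.
  by rewrite nrmZ ler_wpM2l ?cabs_ge0 //; apply/dP/PZ.
pose Q k (p : R[i] * V) := P p.2 /\ nrm (x - (p.2 + p.1 *: v0)) < k.+1%:R^-1.
have exQ k : exists p, Q k p.
  have [|a [y h]] := H k.+1%:R^-1; first by rewrite invr_gt0 ltr0n.
  by exists (a, y).
pose p k := projT1 (cid (exQ k)).
have pP k : Q k (p k) by rewrite /p; case: cid.
have inv_lim (e : R) : 0 < e -> exists N, forall m, (N <= m)%N -> m.+1%:R^-1 < e.
  move=> e0; have e1 : 0 <= e^-1 by rewrite invr_ge0 ltW.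
  exists (Num.bound e^-1) => m Nm; rewrite invf_plt ?posrE ?ltr0n //.
  apply: lt_le_trans (archi_boundP e1) _.
  by rewrite ler_nat; apply: leq_trans Nm _.
have [|l Hl] := @complex_cauchy_lim R (fun k => (p k).1).
  move=> e e0; have [|N HN] := inv_lim (e * d / 2); first by rewrite divr_gt0 // mulr_gt0.
  exists N => m Nm; have [PN hN] := pP N; have [Pm hm] := pP m.
  have := dPa ((p N).1 - (p m).1) ((p N).2 - (p m).2) (PB _ _ PN Pm).
  have -> : (p N).2 - (p m).2 + ((p N).1 - (p m).1) *: v0 =
    ((p N).2 + (p N).1 *: v0) - ((p m).2 + (p m).1 *: v0).
    by rewrite scalerBl opprD addrACA.
  have := nrm_tri x ((p N).2 + (p N).1 *: v0) ((p m).2 + (p m).1 *: v0).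
  rewrite (nrmB _ x); have := HN N (leqnn _); have := HN m Nm => h1 h2 h3 h4.
  rewrite -(ltr_pM2r d0); apply: le_lt_trans h4 _; apply: le_lt_trans h3 _.
  rewrite [e * d]splitr; apply: ltrD; [exact: lt_trans hN h2 | exact: lt_trans hm h1].
exists l; apply: cP => e e0.
have K0 : 0 < 2 * (nrm v0 + 1) by have := nrm_ge0 v0; lra.
have [N1 H1] := inv_lim (e / 2) ltac:(lra).
have [N2 H2] := Hl (e / (2 * (nrm v0 + 1))) (divr_gt0 e0 K0).
set m := maxn N1 N2; have [Pm hm] := pP m.
have := H1 m (leq_maxl _ _); have := H2 m (leq_maxr _ _).
rewrite ltr_pdivlMr // => h2 h1.
exists (p m).2 => //.
have -> : x - l *: v0 - (p m).2 = (x - ((p m).2 + (p m).1 *: v0)) - (l - (p m).1) *: v0.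
  by rewrite scalerBl !opprD opprK !addrA [RHS](addrAC _ (- (l *: v0))) subrK addrAC.
apply: le_lt_trans (nrmD _ _) _; rewrite nrmN nrmZ -/(cabs _).
have h3 := lt_trans hm h1; clear hm h1; have := cabs_ge0 (l - (p m).1); have := nrm_ge0 v0; nra.
Qed.

End SpanClosed.

(** A rank factorisation [E = L *m M] of an idempotent satisfies [M *m L = 1]. *)
(** * Traces of powers and nilpotency *)

Lemma mxtrace_idem (F : fieldType) n (E : 'M[F]_n) :
  E *m E = E -> \tr E = (\rank E)%:R.
Proof.
move=> EE; rewrite -{1}(mulmx_base E) mxtrace_mulC.
suff -> : row_base E *m col_base E = 1%:M by rewrite mxtrace1.
apply: (row_full_inj (col_base_full E)); apply: (row_free_inj (row_base_free E)).
by rewrite mulmx1 mulmxA mulmx_base -mulmxA mulmx_base.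
Qed.

(** Write the characteristic polynomial as [q * 'X^m] with [q] prime to ['X].  A
Bezout relation produces an idempotent [E], polynomial in [H] without constant
term, that is the identity on the invertible part of [H].  Its trace vanishes
by hypothesis and equals its rank, so in characteristic zero [E = 0]. *)
Lemma nilpotent_of_trace0 (F : numFieldType) n (H : 'M[F]_n.+1) :
  (forall k, \tr (H ^+ k.+1) = 0) -> exists m, H ^+ m = 0.
Proof.
move=> tr0.
have trX p : \tr (horner_mx H (p * 'X)) = 0.
  rewrite -(coefK p) poly_def mulr_suml raddf_sum raddf_sum big1 // => i _.
  rewrite -scalerAl -exprSr -mul_polyC /= rmorphM /= horner_mx_C rmorphXn /= horner_mx_X.
  by rewrite -mulmxE mul_scalar_mx mxtraceZ tr0 mulr0.
(* [m] may be zero, so the Bezout relation is taken with ['X ^+ m.+1]. *)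
have [m [q q0 chE]] := multiplicity_XsubC (char_poly H) 0.
rewrite monic_neq0 ?char_poly_monic //= in q0.
rewrite subr0 in chE.
have /Bezout_eq1_coprimepP[[u v] /= uv] : coprimep ('X ^+ m.+1) q.
  by apply: coprimep_expl; rewrite coprimep_sym -['X]subr0 -polyC0 coprimep_XsubC.
pose E := horner_mx H (u * 'X ^+ m.+1); pose E' := horner_mx H (v * q).
have EE' : E + E' = 1 by rewrite -rmorphD uv rmorph1.
have qm0 : horner_mx H (q * 'X^m) = 0 by rewrite -chE Cayley_Hamilton.
have E0 : E * E' = 0.
  have EX : (u * 'X ^+ m.+1) * (v * q) = (u * v * 'X) * (q * 'X^m).
    by rewrite exprS; ring.
  by rewrite -rmorphM EX rmorphM /= qm0 mulr0.
have EE : E * E = E by rewrite -[RHS]mulr1 -EE' mulrDr E0 addr0.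
have := mxtrace_idem EE; rewrite /E exprSr mulrA trX => /esym /eqP.
rewrite pnatr_eq0 mxrank_eq0 => /eqP E1.
exists m; rewrite -[LHS]mul1r -EE' /E exprSr mulrA E1 add0r /E'.
have -> : H ^+ m = horner_mx H 'X^m by rewrite rmorphXn /= horner_mx_X.
by rewrite -rmorphM -mulrA rmorphM /= qm0 mulr0.
Qed.

(** The same for a sequence of powers, which makes sense in every size [n], even
when matrices of that size carry no ring structure. *)
Lemma nilpotent_family_of_trace0 (F : numFieldType) n (H : nat -> 'M[F]_n) :
  H 0%N = 1%:M -> (forall k, H k.+1 = H k *m H 1%N) ->
  (forall k, \tr (H k.+1) = 0) -> exists m, H m = 0.
Proof.
case: n H => [|n] H H0 HS tr0; first by exists 0%N; rewrite [LHS]flatmx0.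
have HX k : H k = H 1%N ^+ k by elim: k => [|k IH]; rewrite // exprSr HS IH.
have [|m Hm] := @nilpotent_of_trace0 _ _ (H 1%N); last by exists m; rewrite HX.
by move=> k; rewrite -HX.
Qed.

(** * Unital finite-dimensional *-subalgebras and their separability idempotents *)

Section Span.
Context {R : realType} {V : lmodType R[i]}.
Implicit Types S : set V.

Lemma spanD S n (v : 'I_n -> V) : is_span S v ->
  forall x y, S x -> S y -> S (x + y).
Proof.
move=> -> x y [c ->] [d ->]; exists (fun i => c i + d i).
by rewrite -big_split; apply: eq_bigr => i _; rewrite scalerDl.
Qed.

Lemma spanZ S n (v : 'I_n -> V) : is_span S v ->
  forall a x, S x -> S (a *: x).
Proof.
move=> -> a x [c ->]; exists (fun i => a * c i).
by rewrite scaler_sumr; apply: eq_bigr => i _; rewrite scalerA.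
Qed.

Lemma span0 S n (v : 'I_n -> V) : is_span S v -> S 0.
Proof.
by move=> ->; exists (fun=> 0); rewrite big1 // => i _; rewrite scale0r.
Qed.

Lemma span_gen S n (v : 'I_n -> V) : is_span S v -> forall i, S (v i).
Proof.
move=> -> i; exists (fun j => (j == i)%:R).
rewrite (bigD1 i) //= eqxx scale1r big1 ?addr0 // => j /negPf ->.
by rewrite scale0r.
Qed.

Definition lin_indep n (v : 'I_n -> V) :=
  forall c : 'I_n -> R[i], \sum_i c i *: v i = 0 -> forall i, c i = 0.

(** A nontrivial relation lets one generator be dropped. *)
Lemma span_basis S n (v : 'I_n -> V) : is_span S v ->
  exists m (b : 'I_m -> V), is_span S b /\ lin_indep b.
Proof.
elim: n v => [|n IH] v Sv.
  by exists 0%N, v; split => // c _ [].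
have [li|] := pselect (lin_indep v); first by exists n.+1, v.
move=> /existsNP[c /not_implyP[c0 /existsNP[i /eqP ci]]].
apply: (IH (fun j => v (lift i j))).
rewrite Sv; apply/seteqP; split => x [d ->]; last first.
  exists (fun j => if unlift i j is Some k then d k else 0).
  rewrite (bigD1_ord i) //= unlift_none scale0r add0r.
  by apply: eq_bigr => k _; rewrite liftK.
exists (fun k => d (lift i k) - d i / c i * c (lift i k)).
have -> : \sum_j d j *: v j = \sum_j (d j - d i / c i * c j) *: v j.
  under [RHS]eq_bigr do rewrite scalerBl -scalerA.
  by rewrite sumrB -scaler_sumr c0 scaler0 subr0.
by rewrite (bigD1_ord i) //= divfK // subrr scale0r add0r.
Qed.

End Span.

Section Algebra.
Context {R : realType} {A : unitalCStarType R}.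
Implicit Types (S : set A).
Definition unital_findim S := is_findim_cstar_subalgebra S /\ S 1.

Section Findim.
Context {S : set A} (uS : unital_findim S).

Lemma findim1 : S 1. Proof. exact: uS.2. Qed.
Lemma findimM x y : S x -> S y -> S (x * y).
Proof. by case: uS => -[_ h _] _; apply: h. Qed.
Lemma findim_star x : S x -> S (star x).
Proof. by case: uS => -[_ _ h] _; apply: h. Qed.
Lemma findimD x y : S x -> S y -> S (x + y).
Proof. by case: uS => -[[n [v Sv]] _ _] _; apply: (spanD Sv). Qed.
Lemma findimZ c x : S x -> S (c *: x).
Proof. by case: uS => -[[n [v Sv]] _ _] _; apply: (spanZ Sv). Qed.
Lemma findim0 : S 0.
Proof. by case: uS => -[[n [v Sv]] _ _] _; apply: (span0 Sv). Qed.
Lemma findimN x : S x -> S (- x).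
Proof. by rewrite -scaleN1r; apply: findimZ. Qed.
Lemma findimB x y : S x -> S y -> S (x - y).
Proof. by move=> Sx Sy; apply: findimD => //; apply: findimN. Qed.
Lemma findim_sum (I : Type) (r : seq I) (P : pred I) (F : I -> A) :
  (forall i, P i -> S (F i)) -> S (\sum_(i <- r | P i) F i).
Proof. by move=> SF; elim/big_ind: _; [exact: findim0 | exact: findimD | exact: SF]. Qed.
Lemma findimX x n : S x -> S (x ^+ n).
Proof.
move=> Sx; elim: n => [|n IH]; first by rewrite expr0; exact: findim1.
by rewrite exprS; apply: findimM.
Qed.
Lemma findim_nclosed : nclosed S.
Proof. by case: uS => -[[n [v ->]] _ _] _; apply: span_nclosed. Qed.

End Findim.

(** The C*-identity gives [nrm (h ^+ (2 ^ k)) = nrm h ^+ (2 ^ k)]. *)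
Lemma sa_nilpotent (h : A) m : star h = h -> h ^+ m = 0 -> h = 0.
Proof.
move=> hs hm; apply: nrm_eq0.
have nk k : nrm (h ^+ (2 ^ k)) = nrm h ^+ (2 ^ k).
  elim: k => [|k IH]; first by rewrite !expr1.
  have sX : star (h ^+ (2 ^ k)) = h ^+ (2 ^ k).
    by elim: (2 ^ k)%N => [|n IHn]; rewrite ?expr0 ?star1 // [in LHS]exprS starM hs IHn exprSr.
  by rewrite expnSr !exprM [in LHS]expr2 -{1}sX nrm_cstar IH.
have : nrm h ^+ (2 ^ m) = 0.
  by rewrite -nk -(subnKC (ltnW (ltn_expl m (ltnSn 1)))) exprD hm mul0r nrm0.
by move/eqP; rewrite expf_eq0 => /andP[_ /eqP].
Qed.

(** Separability idempotent, the sum of the [a i (x) b i]: it commutes with the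
two outer actions of [S] (both expressed by the matrices [X x]) and multiplies
to [1].  Here [a] is a basis and [b] its dual basis for the form
[tau (x * y)], where [tau x] is the trace of left multiplication by [x].  If [x]
lies in the radical of that form then every power of [h := star x * x] has
trace zero, so [h] is nilpotent, hence zero.  The sum of the [a i * b i] pairs
with [a j] to the trace of left multiplication by [a j], so it is [1]. *)
Lemma findim_diagonal S : unital_findim S -> exists n (a b : 'I_n -> A) (X : A -> 'M[R[i]]_n),
  [/\ is_span S a, forall i, S (b i),
     forall x i, S x -> x * a i = \sum_k X x i k *: a k,
     forall x k, S x -> b k * x = \sum_i X x i k *: b i
   & \sum_i a i * b i = 1].
Proof.
move=> uS; case: (uS) => -[[n0 [v0 Sv0]] _ _] _.
have [n [a [Sa li]]] := span_basis Sv0.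
have Sai := span_gen Sa.
pose lc (r : 'rV[R[i]]_n) : A := \sum_i r 0 i *: a i.
have lcS r : S (lc r) by rewrite Sa; exists (r 0).
have lcB r s : lc (r - s) = lc r - lc s.
  by rewrite /lc -sumrB; apply: eq_bigr => i _; rewrite !mxE scalerBl.
have lcD r s : lc (r + s) = lc r + lc s.
  by rewrite /lc -big_split; apply: eq_bigr => i _; rewrite !mxE scalerDl.
have lcI r s : lc r = lc s -> r = s.
  move=> /eqP; rewrite -subr_eq0 -lcB => /eqP /li h; apply/rowP => i.
  by have := h i; rewrite !mxE => /eqP; rewrite subr_eq0 => /eqP.
have exco x : exists r, S x -> lc r = x.
  have [|nS] := pselect (S x); last by exists 0.
  rewrite Sa => -[c ->]; exists (\row_i c i) => _.
  by apply: eq_bigr => i _; rewrite mxE.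
pose co x := projT1 (cid (exco x)).
have coP x : S x -> lc (co x) = x by rewrite /co; case: cid.
pose M x : 'M[R[i]]_n := \matrix_i co (x * a i).
have ME x i : S x -> x * a i = \sum_k M x i k *: a k.
  move=> Sx; rewrite -[LHS]coP; last exact: findimM.
  by apply: eq_bigr => k _; rewrite !mxE.
have lcM x r : S x -> x * lc r = lc (r *m M x).
  move=> Sx; rewrite mulr_sumr /lc.
  under eq_bigr do rewrite scaleAr ME // scaler_sumr.
  rewrite exchange_big /=; apply: eq_bigr => k _; rewrite mxE scaler_suml.
  by apply: eq_bigr => i _; rewrite scalerA.
have Muniq x N : S x -> (forall r, x * lc r = lc (r *m N)) -> M x = N.
  move=> Sx H; apply/row_matrixP => i; rewrite !rowE; apply: lcI.
  by rewrite -lcM // H.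
have MM x y : S x -> S y -> M (x * y) = M y *m M x.
  move=> Sx Sy; apply: Muniq; first exact: findimM.
  by move=> r; rewrite -mulrA !lcM // mulmxA.
have MD x y : S x -> S y -> M (x + y) = M x + M y.
  move=> Sx Sy; apply: Muniq; first exact: findimD.
  by move=> r; rewrite mulrDl !lcM // mulmxDr lcD.
have MZ c x : S x -> M (c *: x) = c *: M x.
  move=> Sx; apply: Muniq; first exact: findimZ.
  move=> r; rewrite scaleAl lcM // -scalemxAr /lc scaler_sumr.
  by apply: eq_bigr => i _; rewrite [in RHS]mxE scalerA.
have M1 : M 1 = 1%:M.
  by apply: Muniq => [|r]; [exact: findim1 | rewrite mul1r mulmx1].
pose tau x := \tr (M x).
have tauD x y : S x -> S y -> tau (x + y) = tau x + tau y.
  by move=> Sx Sy; rewrite /tau MD // mxtraceD.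
have tauZ c x : S x -> tau (c *: x) = c * tau x.
  by move=> Sx; rewrite /tau MZ // mxtraceZ.
have tau_comb (c : 'I_n -> R[i]) (z : 'I_n -> A) : (forall i, S (z i)) ->
    tau (\sum_i c i *: z i) = \sum_i c i * tau (z i).
  move=> Sz; suff [] : S (\sum_i c i *: z i) /\
    tau (\sum_i c i *: z i) = \sum_i c i * tau (z i) by [].
  elim/big_rec2: _ => [|i s t _ [St st]].
    split; first exact: findim0.
    by have := tauZ 0 0 (findim0 uS); rewrite scale0r mul0r.
  split; first by apply: findimD => //; apply: findimZ.
  by rewrite tauD ?tauZ ?st //; apply: findimZ.
have tauB x y : S x -> S y -> tau (x - y) = tau x - tau y.
  move=> Sx Sy; have -> : x - y = x + (-1) *: y by rewrite scaleN1r.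
  by rewrite (tauD _ _ Sx (findimZ uS _ Sy)) (tauZ _ _ Sy) mulN1r.
have tau_lc r y : S y -> tau (lc r * y) = \sum_i r 0 i * tau (a i * y).
  move=> Sy; rewrite mulr_suml; under eq_bigr do rewrite scaleAl.
  by rewrite tau_comb // => i; apply: findimM.
have tauC x y : S x -> S y -> tau (x * y) = tau (y * x).
  by move=> Sx Sy; rewrite /tau !MM // mxtrace_mulC.
have nondeg x : S x -> (forall j, tau (x * a j) = 0) -> x = 0.
  move=> Sx x0.
  have {}x0 y : S y -> tau (x * y) = 0.
    move=> Sy; rewrite tauC // -(coP _ Sy) tau_lc // big1 // => i _.
    by rewrite tauC // x0 mulr0.
  (* The radical is an ideal, by the trace property, so it contains [h]. *)
  pose h := star x * x.
  have Sx' : S (star x) by apply: findim_star.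
  have Sh k : S (h ^+ k) by apply: findimX => //; apply: findimM.
  have [||k|m hm] := @nilpotent_family_of_trace0 _ _ (fun k => M (h ^+ k)).
  - by rewrite expr0.
  - by move=> k; rewrite exprS expr1 MM //; exact: (Sh 1%N).
  - rewrite exprS {1}/h -mulrA -/(tau _) tauC //; last exact: findimM.
    by rewrite -mulrA x0 //; apply: findimM.
  have /sa_nilpotent h0 : h ^+ m = 0.
    rewrite -[LHS]mulr1 -(coP 1) ?lcM ?hm ?mulmx0 //; last exact: findim1.
    by rewrite /lc big1 // => i _; rewrite mxE scale0r.
  apply: nrm_eq0; have := nrm_cstar x; rewrite -/h h0 ?nrm0; last first.
    by rewrite /h starM starK.
  by move/esym/eqP; rewrite expf_eq0 => /andP[_ /eqP].
pose G : 'M[R[i]]_n := \matrix_(i, j) tau (a i * a j).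
have Gu : G \in unitmx.
  rewrite -row_free_unit; apply: inj_row_free => v vG; apply: lcI.
  rewrite (nondeg (lc v)) // => [|j].
    by rewrite /lc big1 // => i _; rewrite mxE scale0r.
  rewrite tau_lc //; have /rowP/(_ j) := vG; rewrite !mxE => h; rewrite -[RHS]h.
  by apply: eq_bigr => i _; rewrite mxE.
pose b i := lc (row i (invmx G)).
have Sb i : S (b i) := lcS _.
have tauba i j : tau (b i * a j) = (i == j)%:R.
  rewrite tau_lc //; have /matrixP/(_ i j) := mulVmx Gu; rewrite !mxE => h; rewrite -[RHS]h.
  by apply: eq_bigr => k _; rewrite !mxE.
exists n, a, b, M; split => // [x k Sx|].
- apply: subr0_eq; apply: nondeg => [|j].
    apply: findimB => //; first exact: findimM.
    by apply: findim_sum => // i _; apply: findimZ.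
  rewrite mulrBl tauB; first last.
  - by apply: findimM => //; apply: findim_sum => // i _; apply: findimZ.
  - by apply: findimM => //; apply: findimM.
  rewrite -mulrA ME // mulr_sumr mulr_suml.
  under eq_bigr do rewrite scaleAr.
  under [in X in _ - X]eq_bigr do rewrite scaleAl.
  rewrite !tau_comb; try by move=> i; apply: findimM.
  rewrite (bigD1 k) //= tauba eqxx mulr1 big1 ?addr0; last first.
    by move=> i /negPf ik; rewrite tauba eq_sym ik mulr0.
  rewrite (bigD1 j) //= tauba eqxx mulr1 big1 ?addr0 ?subrr //.
  by move=> i /negPf ij; rewrite tauba ij mulr0.
- apply: subr0_eq; apply: nondeg => [|j].
    by apply: findimB; [|apply: findim_sum => // i _; apply: findimM|exact: findim1].
  rewrite mulrBl mul1r tauB //; last first.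
    by apply: findimM => //; apply: findim_sum => // i _; apply: findimM.
  apply/eqP; rewrite subr_eq0 mulr_suml; apply/eqP.
  under eq_bigr do rewrite -[a _ * b _ * a _]scale1r.
  rewrite tau_comb; last by move=> i; do 2!apply: findimM => //.
  rewrite /tau /mxtrace; apply: eq_bigr => i _; rewrite mul1r -/(mxtrace _) -/(tau _).
  rewrite -mulrA tauC //; last exact: findimM.
  rewrite -mulrA ME // mulr_sumr; under eq_bigr do rewrite scaleAr.
  rewrite tau_comb; last by move=> k; apply: findimM.
  rewrite (bigD1 i) //= tauba eqxx mulr1 big1 ?addr0 // => k /negPf ki.
  by rewrite tauba eq_sym ki mulr0.
Qed.
End Algebra.

(** * Self-adjoint inverse square roots *)

Section InvSqrt.
Context {R : realType} {A : unitalCStarType R}.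
Implicit Types (x y h : A) (d : R).

Lemma nclosed_and (P Q : A -> Prop) :
  nclosed P -> nclosed Q -> nclosed (fun x => P x /\ Q x).
Proof.
move=> cP cQ x H; split; [apply: (cP x) | apply: (cQ x)] => e /H[y [Py Qy] xy];
by exists y.
Qed.

(** What commutes with [h] commutes with the whole iteration of [inv_sqrt]. *)
Lemma comm_inv_sqrt_step h y x : GRing.comm y h -> GRing.comm y x ->
  GRing.comm y (x + halfC *: (x * (1 - x * x * (1 + h)))).
Proof.
move=> yh yx; apply: commrD => //.
have yE : GRing.comm y (x * (1 - x * x * (1 + h))).
  by do !(apply: commrM || apply: commrB || apply: commrD || apply: commr1 => //) => //.
by rewrite /GRing.comm scaleAl scaleAr yE.
Qed.

(** The inverse of [x] is the square of the inverse square root of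
[x = 1 + (x - 1)]. *)
Lemma inv_near1 x d : 0 < d -> d <= 1/4 -> nrm (x - 1) <= d ->
  exists y, [/\ y * x = 1, x * y = 1, nrm (y - 1) <= 2 * d & nrm y <= 2].
Proof.
move=> d0 d4 xd; have [r [rr r1 rP]] := inv_sqrt d0 d4 xd.
have cx : GRing.comm (x - 1) r.
  apply: (rP (fun r => (x - 1) * r = r * (x - 1))); first exact: nclosed_comm.
  - exact: commr1.
  - by move=> y; apply: comm_inv_sqrt_step.
have x1 : 1 + (x - 1) = x by ncring.
rewrite x1 in rr.
have xr : x * r = r * x.
  have -> : x * r = r + (x - 1) * r by ncring.
  by rewrite cx; ncring.
have xrr : x * (r * r) = 1 by rewrite mulrA xr -mulrA xr mulrA.
have y2 : nrm (r * r) <= 2.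
  have n1 := @nrm1 _ A.
  have : nrm (r * r) <= nrm (1 : A) + nrm (r * r) * nrm (x - 1).
    have {1}-> : r * r = 1 - r * r * (x - 1) by rewrite mulrBr rr; ncring.
    by apply: le_trans (nrmD _ _) _; rewrite nrmN lerD2l nrmM.
  have := nrm_ge0 (r * r); nra.
exists (r * r); split => //.
have -> : r * r - 1 = - (r * r * (x - 1)) by rewrite mulrBr rr; ncring.
rewrite nrmN; apply: le_trans (nrmM _ _) _.
by apply: ler_pM => //; exact: nrm_ge0.
Qed.
Lemma inv_sqrt_sa h d : star h = h -> 0 < d -> d <= 1/4 -> nrm h <= d ->
  exists r, [/\ star r = r, r * r * (1 + h) = 1, nrm (r - 1) <= 2 * d,
    forall y, y * h = h * y -> y * r = r * y
  & forall T : set A, unital_findim T -> T h -> T r].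
Proof.
move=> hs d0 d4 hd; have [r [rr r1 rP]] := inv_sqrt d0 d4 hd.
exists r; split => //.
- have [] // := rP (fun r => star r = r /\ h * r = r * h).
  + by apply: nclosed_and; [exact: nclosed_sa | exact: nclosed_comm].
  + by rewrite star1 mulr1 mul1r.
  + move=> x [xs hx]; split; last exact: comm_inv_sqrt_step.
    set E := 1 - _.
    have xE : GRing.comm x E.
      have xh : GRing.comm x h by [].
      by do !(apply: commrM || apply: commrB || apply: commrD || apply: commr1 => //) => //.
    suff Es : star E = E by rewrite starD star_half starM xs Es xE.
    rewrite /E starB star1 starM starM xs starD star1 hs; congr (_ - _).
    by rewrite mulrDl mul1r mulrA hx -mulrA hx; ncring.
- move=> y yh; apply: (rP (fun r => y * r = r * y)); first exact: nclosed_comm.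
  + exact: commr1.
  + by move=> x; apply: comm_inv_sqrt_step.
- move=> T uT Th; apply: rP; [exact: findim_nclosed | exact: findim1|].
  move=> x Tx; apply: findimD => //; apply: findimZ => //; apply: findimM => //.
  apply: findimB => //; first exact: findim1.
  by apply: findimM => //; [exact: findimM | apply: findimD => //; exact: findim1].
Qed.

End InvSqrt.

(** * Newton iteration towards an inclusion *)

Section Newton.
Context {R : realType} {A : unitalCStarType R}.
Implicit Types (x y : A) (d e : R).

Lemma nrm_sum_le n (F : 'I_n -> A) (M K : R) :
  n%:R <= K -> 0 <= M -> (forall i, nrm (F i) <= M) -> nrm (\sum_i F i) <= K * M.
Proof.
move=> nK M0 FM; apply: le_trans (nrm_sum _ _ _) _.
apply: le_trans (ler_sum _ (fun i _ => FM i)) _.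
by rewrite sumr_const card_ord -[M *+ n]mulr_natl ler_wpM2r.
Qed.

Lemma nrm_scale_le (c : R[i]) x (M K : R) :
  cabs c <= K -> nrm x <= M -> nrm (c *: x) <= K * M.
Proof.
by move=> cK xM; rewrite nrmZ; apply: ler_pM => //; [exact: cabs_ge0 | exact: nrm_ge0].
Qed.

Lemma nrm_mul_le x y (M K : R) :
  nrm x <= K -> nrm y <= M -> nrm (x * y) <= K * M.
Proof.
move=> xK yM; apply: le_trans (nrmM _ _) _.
by apply: ler_pM => //; exact: nrm_ge0.
Qed.

Lemma nrm_add_le x y (M K : R) :
  nrm x <= K -> nrm y <= M -> nrm (x + y) <= K + M.
Proof. by move=> xK yM; apply: le_trans (nrmD _ _) _; apply: lerD. Qed.

Lemma nrm_sub_le x y (M K : R) :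
  nrm x <= K -> nrm y <= M -> nrm (x - y) <= K + M.
Proof. by move=> xK yM; apply: nrm_add_le; rewrite ?nrmN. Qed.

(** Right multiplication by an element near [1] is bounded below; this replaces
any use of an inverse of [W] while iterating. *)
Lemma nrm_near1_mul x (W : A) : nrm (W - 1) <= 1 / 2 -> nrm x <= 2 * nrm (x * W).
Proof.
move=> W2; have : nrm x <= nrm (x * W) + nrm x * (1 / 2).
  have {1}-> : x = x * W - x * (W - 1) by ncring.
  by apply: nrm_sub_le => //; apply: nrm_mul_le.
lra.
Qed.

(** A separability idempotent of [S] with one constant [dg_K] bounding the number
of terms, the elements and all the coefficients involved, so that the error
estimates are polynomials in [dg_K]; [dg_c] expresses [b] in the basis [a]. *)
Record bounded_diagonal (S : set A) := BoundedDiagonal {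
  dg_n : nat;
  dg_a : 'I_dg_n -> A;
  dg_b : 'I_dg_n -> A;
  dg_X : A -> 'M[R[i]]_dg_n;
  dg_c : 'I_dg_n -> 'I_dg_n -> R[i];
  dg_K : R;
  dg_span : is_span S dg_a;
  dg_Xa : forall x i, S x -> x * dg_a i = \sum_k dg_X x i k *: dg_a k;
  dg_bX : forall x k, S x -> dg_b k * x = \sum_i dg_X x i k *: dg_b i;
  dg_ab1 : \sum_i dg_a i * dg_b i = 1;
  dg_bE : forall j, dg_b j = \sum_k dg_c j k *: dg_a k;
  dg_K1 : 1 <= dg_K;
  dg_nK : dg_n%:R <= dg_K;
  dg_aK : forall k, nrm (dg_a k) <= dg_K;
  dg_bK : forall k, nrm (dg_b k) <= dg_K;
  dg_XK : forall k i j, cabs (dg_X (dg_a k) i j) <= dg_K;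
  dg_cK : forall i j, cabs (dg_c i j) <= dg_K
}.

Arguments dg_a {S} _ _.
Arguments dg_b {S} _ _.
Arguments dg_c {S} _ _ _.

Lemma ord_bound n (F : 'I_n -> R) : exists2 M, 0 <= M & forall i, F i <= M.
Proof.
exists (\sum_i `|F i|); first exact: sumr_ge0.
move=> i; rewrite (bigD1 i) //=; apply: le_trans (ler_norm _) _.
by rewrite lerDl sumr_ge0.
Qed.

Lemma bounded_diagonal_exists S : unital_findim S -> exists D : bounded_diagonal S, True.
Proof.
move=> uS; have [n [a [b [X [Sa Sb Xa bX ab1]]]]] := findim_diagonal uS.
have /choice[c bE] j : exists c : 'I_n -> R[i], b j = \sum_k c k *: a k.
  by have := Sb j; rewrite {1}Sa.
(* The constant is the sum of the bounds for each kind of data, plus [1]. *)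
have [K1 K10 aK] := ord_bound (fun k => nrm (a k)).
have [K2 K20 bK] := ord_bound (fun k => nrm (b k)).
have /choice[K3 XK] k : exists M, 0 <= M /\ forall i j, cabs (X (a k) i j) <= M.
  have /choice[M MP] i : exists M, 0 <= M /\ forall j, cabs (X (a k) i j) <= M.
    by have [M M0 MP] := ord_bound (fun j => cabs (X (a k) i j)); exists M.
  have [M' M'0 M'P] := ord_bound M; exists M'; split => // i j.
  exact: le_trans ((MP i).2 j) (M'P i).
have [K3' K30 K3P] := ord_bound K3.
have /choice[K4 cK] i : exists M, forall j, cabs (c i j) <= M.
  by have [M M0 MP] := ord_bound (fun j => cabs (c i j)); exists M.
have [K4' K40 K4P] := ord_bound K4.
have n0 : 0 <= n%:R :> R := ler0n _ _.
unshelve eexists (@BoundedDiagonal S n a b X c (1 + n%:R + K1 + K2 + K3' + K4') Sa Xa bX ab1 bE _ _ _ _ _ _) => //.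
- lra.
- lra.
- by move=> k; have := aK k; lra.
- by move=> k; have := bK k; lra.
- by move=> k i j; have := (XK k).2 i j; have := K3P k; lra.
- by move=> i j; have := cK i j; have := K4P i; lra.
Qed.

(** Put [W1] for the sum of the [t i * W * b i].  If [W * a k = t k * W] held exactly
then [W1 = W], since the [a i * b i] sum to [1]; and moving [a k] through the
idempotent gives [W1 * a k = t k * W1 + (sum over j of D k j * W * b j)], where
[D k j] in [T] measures the failure of [a i |-> t i] to be multiplicative and
is of order [d].  Replacing [W * b j] by [f j * W1], with [f j] in [T] the image
of [b j], costs an error of order [d] inside a term of order [d], and the new
leading term can be absorbed into [t1 k], again in [T]. *)
Lemma newton_step (S : set A) (D : bounded_diagonal S) (T : set A) (W : A)
    (t : 'I_(dg_n D) -> A) d :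
  unital_findim S -> unital_findim T -> 0 < d -> d <= 1 -> nrm (W - 1) <= 1 / 2 -> (forall k, T (t k)) ->
  (forall k, nrm (W * dg_a D k - t k * W) <= d) ->
  exists W1 t1, [/\ nrm (W1 - W) <= dg_K D ^+ 2 * d, forall k, T (t1 k)
    & forall k, nrm (W1 * dg_a D k - t1 k * W1) <= 112 * dg_K D ^+ 8 * d ^+ 2].
Proof.
case: D t => n a b X be K Sa xa bx ab1 bE K1 nK aK bK XK beK /= t.
move=> uS uT d0 d1 W12 Tt Ed.
have Sak := span_gen Sa.
pose E k := W * a k - t k * W.
have {}Ed k : nrm (E k) <= d := Ed k.
have WE k : W * a k = t k * W + E k by rewrite /E; ncring.
have K0 : 0 <= K by exact: le_trans ler01 K1.
have W2 : nrm W <= 2.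
  have -> : W = 1 + (W - 1) by ncring.
  by apply: le_trans (nrm_add_le (@nrm1 _ A) W12) _; lra.
have t6 k : nrm (t k) <= 6 * K.
  have := nrm_near1_mul (t k) W12.
  have : nrm (t k * W) <= 2 * K + d.
    have -> : t k * W = W * a k - E k by rewrite /E; ncring.
    by apply: nrm_sub_le => //; apply: nrm_mul_le.
  lra.
pose W1 := \sum_i t i * W * b i.
have W1W : W1 - W = - \sum_i E i * b i.
  rewrite -[in LHS](mulr1 W) -ab1 mulr_sumr -sumrB -sumrN; apply: eq_bigr => i _.
  by rewrite /E; ncring.
have W1d : nrm (W1 - W) <= K ^+ 2 * d.
  rewrite W1W nrmN (_ : K ^+ 2 * d = K * (d * K)); last by ring.
  apply: nrm_sum_le => //; first by rewrite mulr_ge0 // ltW.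
  by move=> i; apply: nrm_mul_le.
pose s k j := \sum_i X (a k) j i *: t i.
pose D k j := s k j - t k * t j : A.
have Ts k j : T (s k j) by apply: findim_sum => // i _; apply: findimZ.
have TD k j : T (D k j) by apply: findimB => //; apply: findimM.
have sW k j : s k j * W = W * (a k * a j) - \sum_i X (a k) j i *: E i.
  rewrite xa // mulr_suml mulr_sumr -sumrB; apply: eq_bigr => i _.
  by rewrite scaleAl scaleAr -scalerBr /E; congr (_ *: _); ncring.
have Dd k j : nrm (D k j) <= 16 * K ^+ 2 * d.
  apply: le_trans (nrm_near1_mul _ W12) _.
  have -> : D k j * W = (t k * E j + E k * a j) - \sum_i X (a k) j i *: E i.
    have -> : D k j * W = s k j * W - t k * t j * W by rewrite /D; ncring.
    by rewrite sW mulrA WE /E; ncring.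
  have h : nrm ((t k * E j + E k * a j) - \sum_i X (a k) j i *: E i) <=
      (6 * K * d + d * K) + K * (K * d).
    apply: nrm_sub_le.
      by apply: nrm_add_le; apply: nrm_mul_le.
    apply: nrm_sum_le => //; first by rewrite mulr_ge0 // ltW.
    by move=> i; apply: nrm_scale_le.
  have : K * d <= K ^+ 2 * d by rewrite ler_pM2r // expr2 ler_peMr.
  lra.
pose f j := \sum_k be j k *: t k.
have Tf j : T (f j) by apply: findim_sum => // i _; apply: findimZ.
have fK j : nrm (f j) <= 6 * K ^+ 3.
  rewrite (_ : 6 * K ^+ 3 = K * (K * (6 * K))); last by ring.
  apply: nrm_sum_le => //; first by rewrite !mulr_ge0.
  by move=> i; apply: nrm_scale_le.
have fE j : W * b j - f j * W = \sum_k be j k *: E k.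
  rewrite bE mulr_sumr mulr_suml -sumrB; apply: eq_bigr => k _.
  by rewrite scaleAl scaleAr -scalerBr.
pose t1 k := t k + \sum_j D k j * f j.
have Tt1 k : T (t1 k).
  by apply: findimD => //; apply: findim_sum => // j _; apply: findimM.
exists W1, t1; split => // k.
have W1a : W1 * a k = t k * W1 + \sum_j D k j * W * b j.
  have -> : W1 * a k = \sum_j s k j * W * b j.
    rewrite mulr_suml.
    under eq_bigr do rewrite -mulrA bx // mulr_sumr.
    rewrite exchange_big /=; apply: eq_bigr => j _.
    rewrite /s !mulr_suml; apply: eq_bigr => i _.
    by rewrite scaleAr !scaleAl.
  rewrite mulr_sumr -big_split; apply: eq_bigr => j _ /=.
  by rewrite /D; ncring.
have -> : W1 * a k - t1 k * W1 = \sum_j D k j * ((\sum_k be j k *: E k) - f j * (W1 - W)).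
  rewrite W1a /t1 mulrDl mulr_suml.
  have -> (x y z : A) : x + y - (x + z) = y - z by ncring.
  rewrite -sumrB; apply: eq_bigr => j _; rewrite -fE; ncring.
rewrite (_ : 112 * K ^+ 8 * d ^+ 2 = K * ((16 * K ^+ 2 * d) * (7 * K ^+ 5 * d))); last by ring.
have p0 m : 0 <= K ^+ m by rewrite exprn_ge0.
apply: nrm_sum_le => //.
  by rewrite !mulr_ge0 // ltW.
move=> j; apply: nrm_mul_le => //.
have : nrm (\sum_k be j k *: E k - f j * (W1 - W)) <= K * (K * d) + 6 * K ^+ 3 * (K ^+ 2 * d).
  apply: nrm_sub_le.
    apply: nrm_sum_le => //; first by rewrite mulr_ge0 // ltW.
    by move=> i; apply: nrm_scale_le.
  by apply: nrm_mul_le.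
have : K ^+ 2 * d <= K ^+ 5 * d.
  by rewrite ler_pM2r // ler_weXn2l.
lra.
Qed.

End Newton.

Arguments dg_a {R A S} _ _.
Arguments dg_b {R A S} _ _.
Arguments dg_c {R A S} _ _ _.
Arguments dg_X {R A S} _ _.
Arguments dg_K {R A S} _.

(** * Almost included finite-dimensional algebras are unitarily included *)

Section Perturb.
Context {R : realType} {A : unitalCStarType R}.
Implicit Types (x y : A) (d e : R) (S T : set A).

(** Limit of the Newton steps.  The conjugates [W * a k * W'] are limits of
elements of [T], and [T] is closed. *)
Lemma intertwiner S (D : bounded_diagonal S) T d :
  unital_findim S -> unital_findim T -> 0 < d -> 224 * dg_K D ^+ 8 * d <= 1 ->
  (forall k, exists2 t, T t & nrm (dg_a D k - t) <= d) ->
  exists W W' : A, [/\ nrm (W - 1) <= 2 * dg_K D ^+ 2 * d, W' * W = 1, W * W' = 1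
    & forall x, S x -> T (W * x * W')].
Proof.
move=> uS uT d0 dsmall near.
have K1 := dg_K1 D; set K := dg_K D in K1 dsmall *.
have K28 : K ^+ 2 <= K ^+ 8 by rewrite ler_weXn2l.
have K18 : 1 <= K ^+ 8 by rewrite exprn_ege1.
have K12 : K <= K ^+ 2 by rewrite ler_eXnr.
have Kd8 : K ^+ 2 * d <= K ^+ 8 * d by rewrite ler_pM2r.
have d18 : d <= K ^+ 8 * d by rewrite ler_peMl // ltW.
pose P (W : A) e := exists t : 'I_(dg_n D) -> A,
  (forall k, T (t k)) /\ forall k, nrm (W * dg_a D k - t k * W) <= e.
have P1 : P 1 d.
  have /choice[t tP] k : exists t, T t /\ nrm (dg_a D k - t) <= d.
    by have [t Tt kt] := near k; exists t.
  exists t; split=> k; first exact: (tP k).1.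
  by rewrite mul1r mulr1; exact: (tP k).2.
have K20 : 0 <= K ^+ 2 by rewrite exprn_ge0 //; lra.
have [|W W1 Wlim] := geometric_iteration K20 d0 P1.
  move=> W e e0 ed W1 [t [Tt Et]].
  have [||W1' [t1 [W1W Tt1 Et1]]] := @newton_step _ _ S D T W t e uS uT e0 _ _ Tt Et.
  - by lra.
  - by lra.
  exists W1' => //; exists t1; split => // k.
  apply: le_trans (Et1 k) _; rewrite -/K.
  have : K ^+ 8 * e <= K ^+ 8 * d by rewrite ler_wpM2l //; lra.
  have : 112 * K ^+ 8 * e ^+ 2 = 112 * (K ^+ 8 * e) * e by ring.
  nra.
have W1' : nrm (W - 1) <= 1 / 4 by lra.
have [W' [W'W WW' W'1 W'2]] := inv_near1 (ltac:(lra) : 0 < 1 / 4 :> R) (lexx _) W1'.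
exists W, W'; split => //.
have Tak k : T (W * dg_a D k * W').
  apply: (findim_nclosed uT) => e e0.
have K0 : 0 < K by lra.
  have e20 : 0 < e / (40 * K) by rewrite divr_gt0 // mulr_gt0.
  have [|V [e' [WV e'0 e'e [t [Tt Et]]]]] := Wlim (Num.min (e / (40 * K)) (1 / 4)).
    by rewrite lt_min e20 /=; lra.
  move: WV e'e; rewrite !lt_min => /andP[WV WV4] /andP[e'e e'4].
  exists (t k) => //.
  have -> : W * dg_a D k * W' - t k =
     ((W - V) * dg_a D k + (V * dg_a D k - t k * V) + t k * (V - W)) * W'.
    have -> : W * dg_a D k * W' - t k = W * dg_a D k * W' - t k * (W * W').
      by rewrite WW' mulr1.
    by ncring.
  have V12 : nrm (V - 1) <= 1 / 2.
    by have := nrm_tri W V 1; rewrite (nrmB V W); lra.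
  have V2 : nrm V <= 2.
    have -> : V = 1 + (V - 1) by ncring.
    by apply: le_trans (nrm_add_le (@nrm1 _ A) V12) _; lra.
  have t6 : nrm (t k) <= 6 * K.
    have := nrm_near1_mul (t k) V12.
    have : nrm (t k * V) <= 2 * K + e'.
      have -> : t k * V = V * dg_a D k - (V * dg_a D k - t k * V) by ncring.
      by apply: nrm_sub_le => //; apply: nrm_mul_le => //; exact: dg_aK.
    lra.
  have VW : nrm (V - W) <= e / (40 * K) by rewrite nrmB ltW.
  have h : nrm (((W - V) * dg_a D k + (V * dg_a D k - t k * V) + t k * (V - W)) * W') <=
    (e / (40 * K) * K + e / (40 * K) + 6 * K * (e / (40 * K))) * 2.
    apply: nrm_mul_le => //; apply: nrm_add_le; last exact: nrm_mul_le.
    apply: nrm_add_le; last by apply: le_trans (Et k) _; exact: ltW.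
    by apply: nrm_mul_le; [exact: ltW | exact: dg_aK].
  apply: le_lt_trans h _.
  have h : e / (40 * K) * K = e / 40 by field; lra.
  have h2 : e / (40 * K) <= e / 40.
    by rewrite -h ler_peMr // ltW.
  have -> : 6 * K * (e / (40 * K)) = 6 * (e / (40 * K) * K) by ring.
  rewrite h; lra.
move=> x; rewrite (dg_span D) => -[c ->].
rewrite mulr_sumr mulr_suml; apply: findim_sum => // k _.
by rewrite scaleAr scaleAl; apply: findimZ.
Qed.

Lemma nrm_mul1 x y (dx dy : R) : nrm (x - 1) <= dx -> nrm (y - 1) <= dy -> nrm x <= 2 ->
  nrm (x * y - 1) <= 2 * dy + dx.
Proof.
move=> xd yd x2; have -> : x * y - 1 = x * (y - 1) + (x - 1) by ncring.
by apply: nrm_add_le => //; apply: nrm_mul_le.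
Qed.

Lemma nrm_near1_le2 x : nrm (x - 1) <= 1 -> nrm x <= 2.
Proof.
move=> x1; have -> : x = 1 + (x - 1) by ncring.
by apply: le_trans (nrm_add_le (@nrm1 _ A) x1) _; lra.
Qed.

Lemma nrm_star1 x : nrm (star x - 1) = nrm (x - 1).
Proof. by rewrite -nrm_star starB starK star1. Qed.
(** From the invertible [W] with [W * S * W'] in [T] to a unitary.  Let [c] be the
sum of the [a i * star W * W * b i]: it is close to [1], commutes with [S], and
[star W' * c * W'] is the sum of the [star (W * star (a i) * W') * (W * b i * W')],
so it lies in [T].  The same holds for the self-adjoint part [c'], so
[h := star W' * c' * W'] is in [T].  With [s] the square root of [h], the element
[V := s * W] satisfies [star V * V = c'], which commutes with [S]; hence the
polar part [U := V * rho], [rho] the inverse square root of [c'], conjugates [S]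
exactly as [V] does, that is, into [T]. *)
Lemma near_inclusion S : unital_findim S -> exists n (a : 'I_n -> A) (L : R),
  [/\ forall i, S (a i), 0 < L & forall d T, 0 < d -> L * d <= 1 -> unital_findim T ->
   (forall k, exists2 t, T t & nrm (a k - t) <= d) ->
   exists U : A, [/\ star U * U = 1, U * star U = 1, nrm (U - 1) <= L * d
     & forall x, S x -> T (U * x * star U)]].
Proof.
move=> uS; have [D _] := bounded_diagonal_exists uS.
have K1 := dg_K1 D; set K := dg_K D in K1 *.
have K58 : K ^+ 5 <= K ^+ 8 by rewrite ler_weXn2l.
have K18 : 1 <= K ^+ 8 by rewrite exprn_ege1.
exists (dg_n D), (dg_a D), (1000 * K ^+ 8); split.
- exact: span_gen (dg_span D).
- by lra.
move=> d T d0 Ld uT near.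
have K8d0 : 0 < K ^+ 8 * d by rewrite mulr_gt0 //; lra.
have [|W [W' [W1 W'W WW' TW]]] := intertwiner uS uT d0 _ near; first by rewrite -/K; lra.
(* [K ^+ 3] times the bound on [W - 1]; averaging over the idempotent costs the
   factor [K ^+ 3]. *)
pose w := 2 * K ^+ 5 * d.
have K0 : 0 < K by lra.
have w0 : 0 < w by rewrite /w mulr_gt0 // mulr_gt0 // exprn_gt0.
have wsmall : 500 * w <= 1.
  have : K ^+ 5 * d <= K ^+ 8 * d by rewrite ler_pM2r.
  by rewrite /w; lra.
have K3w : K ^+ 3 * nrm (W - 1) <= w.
  have -> : w = K ^+ 3 * (2 * K ^+ 2 * d) by rewrite /w; ring.
  by rewrite ler_wpM2l // exprn_ge0 //; lra.
have Ww : nrm (W - 1) <= w.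
  apply: le_trans K3w; rewrite ler_peMl ?nrm_ge0 // exprn_ege1 //.
have W2 : nrm W <= 2 by apply: nrm_near1_le2; lra.
have [W0 [_ WW0 W01 W02]] := inv_near1 w0 (ltac:(lra) : w <= 1/4) Ww.
have W0E : W0 = W' by rewrite -[W0]mul1r -W'W -mulrA WW0 mulr1.
rewrite {}W0E {WW0} in W01 W02.
pose k := star W * W - 1.
have kw : nrm k <= 3 * nrm (W - 1).
  have -> : 3 * nrm (W - 1) = 2 * nrm (W - 1) + nrm (W - 1) by ring.
  by apply: nrm_mul1; rewrite ?nrm_star1 ?nrm_star.
pose c := \sum_i dg_a D i * (star W * W) * dg_b D i.
have cw : nrm (c - 1) <= 3 * w.
  have -> : c - 1 = \sum_i dg_a D i * k * dg_b D i.
    rewrite -(dg_ab1 D) -sumrB; apply: eq_bigr => i _; rewrite /k; ncring.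
  apply: le_trans (_ : _ <= K * (K * (3 * nrm (W - 1)) * K)) _.
    apply: nrm_sum_le; first exact: dg_nK.
      by rewrite !mulr_ge0 ?nrm_ge0 //; lra.
    move=> i; apply: nrm_mul_le; last exact: dg_bK.
    by apply: nrm_mul_le => //; exact: dg_aK.
  have -> : K * (K * (3 * nrm (W - 1)) * K) = 3 * (K ^+ 3 * nrm (W - 1)) by ring.
  lra.
have cS x : S x -> x * c = c * x.
  move=> Sx; rewrite mulr_sumr mulr_suml.
  under eq_bigr do rewrite 2!mulrA dg_Xa // !mulr_suml.
  under [RHS]eq_bigr do rewrite -mulrA dg_bX // mulr_sumr.
  rewrite exchange_big /=; apply: eq_bigr => i _; apply: eq_bigr => j _.
  by rewrite !scaleAl scaleAr.
pose c' := halfC *: (c + star c).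
have c'w : nrm (c' - 1) <= 3 * w.
  have -> : c' - 1 = halfC *: ((c - 1) + (star c - 1)).
    rewrite -[in LHS](half2 1) -scalerDr /c' -scalerBr; congr (_ *: _); ncring.
  have := nrmD (c - 1) (star c - 1).
  by rewrite nrm_half nrm_star1; lra.
have c's : star c' = c' by rewrite star_half starD starK addrC.
have c'S x : S x -> x * c' = c' * x.
  move=> Sx; rewrite scaleAr scaleAl mulrDr mulrDl cS //; congr (_ *: (_ + _)).
  apply: (can_inj (@starK _ A)); rewrite !starM !starK cS //.
  exact: findim_star.
pose h := star W' * c' * W'.
have hT : T h.
  have Thc : T (star W' * c * W').
    rewrite mulr_sumr mulr_suml; apply: findim_sum => // i _.
    have -> : star W' * (dg_a D i * (star W * W) * dg_b D i) * W' =
      star (W * star (dg_a D i) * W') * (W * dg_b D i * W').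
      by rewrite !starM starK; ncring.
    have Sa := span_gen (dg_span D).
    apply: findimM => //; last first.
      apply: TW; rewrite dg_bE; apply: findim_sum => // j _.
      by apply: findimZ.
    by apply: findim_star => //; apply: TW; apply: findim_star.
  have -> : h = halfC *: (star W' * c * W' + star (star W' * c * W')).
    rewrite !starM starK /h /c' scaleAr scaleAl; congr (_ *: _); ncring.
  by apply: findimZ => //; apply: findimD => //; apply: findim_star.
have hs : star h = h by rewrite /h !starM starK c's mulrA.
have h18 : nrm (h - 1) <= 18 * w.
  have t1 : nrm (star W' * c' - 1) <= 2 * (3 * w) + 2 * w.
    by apply: nrm_mul1; rewrite ?nrm_star1 ?nrm_star.
  have := nrm_mul1 t1 W01; rewrite -/h.
  have : nrm (star W' * c') <= 2 by apply: nrm_near1_le2; lra.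
  by move=> t2 /(_ t2); lra.
have [||||r [rs rr r1 rcomm rT]] := @inv_sqrt_sa _ A (h - 1) (18 * w).
- by rewrite starB hs star1.
- by lra.
- by lra.
- by [].
have h1 : 1 + (h - 1) = h by ncring.
rewrite h1 in rr.
have {}rT : T r by apply: rT => //; apply: findimB => //; exact: findim1.
have hr : h * r = r * h.
  by apply: rcomm; ncring.
have [||||rho [rhos rhorho rho1 rhocomm _]] := @inv_sqrt_sa _ A (c' - 1) (3 * w).
- by rewrite starB c's star1.
- by lra.
- by lra.
- by [].
have c1 : 1 + (c' - 1) = c' by ncring.
rewrite c1 in rhorho.
have {}rhoS x : S x -> x * rho = rho * x.
  by move=> Sx; apply: rhocomm; rewrite mulrBr mulrBl c'S // mulr1 mul1r.
have crho : c' * rho = rho * c' by apply: rhocomm; ncring.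
pose s := h * r.
have sr : s * r = 1 by rewrite /s hr -mulrA hr mulrA.
have rs1 : r * s = 1 by rewrite /s hr mulrA.
have ss : star s = s by rewrite /s starM hs rs.
have sT : T s by apply: findimM.
have ssh : s * s = h by rewrite {2}/s hr mulrA sr mul1r.
have s90 : nrm (s - 1) <= 90 * w.
  have := nrm_mul1 h18 r1; rewrite -/s.
  have : nrm h <= 2 by apply: nrm_near1_le2; lra.
  by move=> t2 /(_ t2); lra.
clearbody s.
have rcr : rho * c' * rho = 1 by rewrite -mulrA crho mulrA.
pose U := s * W * rho.
have UU : star U * U = 1.
  have WhW : star W * h * W = c'.
    have -> : star W * h * W = star (W' * W) * c' * (W' * W).
      by rewrite starM /h; ncring.
    by rewrite W'W star1 mul1r mulr1.
  have -> : star U * U = rho * (star W * (s * s) * W) * rho.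
    by rewrite /U !starM ss rhos; ncring.
  by rewrite ssh WhW.
have UUs : U * star U = 1.
  pose V := c' * rho * W' * r.
  have UV : U * V = 1.
    have -> : U * V = s * (W * (rho * c' * rho) * W') * r by rewrite /U /V; ncring.
    by rewrite rcr mulr1 WW' mulr1.
  by rewrite -[star U]mulr1 -UV [star U * _]mulrA UU mul1r.
exists U; split => //.
- have s2 : nrm s <= 2 by apply: nrm_near1_le2; lra.
  have sW := nrm_mul1 s90 Ww s2.
  have sW2 : nrm (s * W) <= 2 by apply: nrm_near1_le2; lra.
  have := nrm_mul1 sW rho1 sW2; rewrite -/U.
  have : K ^+ 5 * d <= K ^+ 8 * d by rewrite ler_pM2r.
  by rewrite /w; lra.
- move=> x Sx.
  have Ux : U * x = s * (W * x * W') * r * U.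
    rewrite /U; have -> : s * (W * x * W') * r * (s * W * rho) =
      s * W * x * (W' * (r * s) * W) * rho by ncring.
    rewrite rs1 mulr1 W'W mulr1 -!mulrA; do 2!congr (_ * _).
    by rewrite rhoS.
  rewrite Ux -mulrA UUs mulr1; apply: findimM => //; apply: findimM => //.
  exact: TW.
Qed.

End Perturb.

(** * Uniform boundedness of representations *)

Section Representation.
Context {R : realType} {A : unitalCStarType R} {H : hilbertSpace R}.
Context (pi : A -> H -> H).
Context (rpi : is_representation pi).

Lemma rep_comb c a b x : pi (c *: a + b) x = c *: pi a x + pi b x.
Proof. by case: rpi. Qed.

Lemma rep0 x : pi 0 x = 0.
Proof.
have := rep_comb 1 0 0 x; rewrite !scale1r addr0 => /eqP.
by rewrite -subr_eq subrr eq_sym => /eqP.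
Qed.

Lemma repZ c a x : pi (c *: a) x = c *: pi a x.
Proof. by rewrite -[c *: a]addr0 rep_comb rep0 addr0. Qed.

Lemma repB a b x : pi (a - b) x = pi a x - pi b x.
Proof. by rewrite -scaleN1r addrC rep_comb scaleN1r addrC. Qed.

Lemma inner_nrm (x : H) : inner x x = (nrm x ^+ 2)%:C.
Proof. by rewrite -norm_inner nrmE rmorphXn. Qed.

Lemma rep_inner a x : inner x (pi (star a * a) x) = (nrm (pi a x) ^+ 2)%:C.
Proof.
have [_ _ piM piS] := rpi.
by rewrite piM -inner_nrm piS.
Qed.

(** [pi 1] is an orthogonal projection: expand the square norm of [x - pi 1 x]. *)
Lemma rep1_le x : nrm (pi 1 x) ^+ 2 <= nrm x ^+ 2.
Proof.
have [_ _ _ piS] := rpi.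
have i1 : inner x (pi 1 x) = (nrm (pi 1 x) ^+ 2)%:C.
  by rewrite -rep_inner star1 mulr1.
have i2 : inner (pi 1 x) x = (nrm (pi 1 x) ^+ 2)%:C by rewrite piS star1 i1.
have : inner (x - pi 1 x) (x - pi 1 x) = (nrm x ^+ 2 - nrm (pi 1 x) ^+ 2)%:C.
  rewrite linearBl !linearBr /= i1 i2 !inner_nrm subrr subr0.
  by rewrite -rmorphB.
rewrite inner_nrm => /complexI h; rewrite -subr_ge0 -h.
by rewrite sqr_ge0.
Qed.
(** If [nrm b = 1/2] then [1 - star b * b = star s * s] for some [s], so
[nrm (pi b x) ^+ 2 + nrm (pi s x) ^+ 2 = nrm (pi 1 x) ^+ 2], and the first term is
at most [nrm x ^+ 2].  The constant [2] spares the spectral radius argument that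
gives contractivity, and any uniform constant serves. *)
Lemma rep_bound a x : nrm (pi a x) <= 2 * nrm a * nrm x.
Proof.
have := nrm_ge0 a; rewrite le_eqVlt => /orP[/eqP/esym/nrm_eq0 ->|a0].
  by rewrite rep0 !nrm0 mulr0 mul0r.
pose t := (2 * nrm a)^-1.
have t0 : 0 < t by rewrite invr_gt0 mulr_gt0.
pose b := t%:C *: a.
have b2 : nrm b = 1 / 2.
  by rewrite nrmZr gtr0_norm // /t; field; rewrite lt0r_neq0.
suff h : nrm (pi b x) <= nrm x.
  move: h; rewrite repZ nrmZr gtr0_norm // /t mulrC ler_pdivrMr ?mulr_gt0 //.
  by rewrite mulrC.
have bb : nrm (- (star b * b)) <= 1 / 4 by rewrite nrmN nrm_cstar b2; lra.
have [||r [rs rr _ rc _]] := inv_sqrt_sa _ _ (lexx _) bb.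
- by rewrite starN starM starK.
- by lra.
pose c := star b * b; pose s := (1 - c) * r.
have cr : c * r = r * c.
  by apply: oppr_inj; rewrite -(mulNr c) -(mulrN r); apply: rc.
have ss : star s * s = 1 - c.
  rewrite /s starM starB star1 rs {1}/c starM starK -/c.
  rewrite (_ : r * (1 - c) * ((1 - c) * r) = (1 - c) * (r * r * (1 - c))); last first.
    rewrite -/c in rr *.
    have e1 : r * (1 - c) = (1 - c) * r by rewrite mulrBr mulrBl cr mulr1 mul1r.
    by rewrite e1 -!mulrA; congr (_ * _); rewrite e1.
  by rewrite rr mulr1.
have : nrm (pi b x) ^+ 2 + nrm (pi s x) ^+ 2 <= nrm x ^+ 2.
  apply: le_trans (rep1_le x); rewrite le_eqVlt; apply/orP; left; apply/eqP.
  apply: complexI; rewrite rmorphD /= -!rep_inner ss -/c repB linearBr /=.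
  by rewrite star1 mulr1 addrCA subrr addr0.
have := sqr_ge0 (nrm (pi s x)).
have := nrm_ge0 x; have := nrm_ge0 (pi b x); nra.
Qed.

End Representation.

(** * Canonical generators of the crossed product *)

Section CrossedProductGenerators.
Context {R : realType} {gT : finGroupType} {A : unitalCStarType R}.
Context (alpha : gT -> A -> A) (B : unitalCStarType R) (iota : {ffun gT -> A} -> B).
Context (act : is_cstar_action alpha).

Lemma action_lin g c a b : alpha g (c *: a + b) = c *: alpha g a + alpha g b.
Proof. by have [h _] := act; have [l _ _ _] := h g; rewrite l. Qed.
Lemma actionM g a b : alpha g (a * b) = alpha g a * alpha g b.
Proof. by have [h _] := act; have [_ l _ _] := h g; rewrite l. Qed.
Lemma action_star g a : alpha g (star a) = star (alpha g a).
Proof. by have [h _] := act; have [_ _ l _] := h g; rewrite l. Qed.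
Lemma action_comp g h a : alpha (g * h)%g a = alpha g (alpha h a).
Proof. by have [_ l] := act; rewrite l. Qed.
Lemma action_id a : alpha 1%g a = a.
Proof.
have [h _] := act; have [_ _ _ [f fK _]] := h 1%g.
by rewrite -[LHS]fK -action_comp mulg1 fK.
Qed.
Lemma action0 g : alpha g 0 = 0.
Proof.
have := action_lin g 1 0 0; rewrite !scale1r addr0 => /eqP.
by rewrite -subr_eq subrr eq_sym => /eqP.
Qed.
Lemma action1 g : alpha g 1 = 1.
Proof.
have [h _] := act; have [_ _ _ [f _ fK]] := h g.
by rewrite -[LHS]mulr1 -{2}(fK 1) -actionM mul1r fK.
Qed.

Definition point_mass g a : {ffun gT -> A} := [ffun s => if s == g then a else 0].

Lemma point_mass_conv g a h b :
  convolution alpha (point_mass g a) (point_mass h b) = point_mass (g * h)%g (a * alpha g b).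
Proof.
apply/ffunP => s; rewrite !ffunE (bigD1 g) //= !ffunE eqxx big1 ?addr0.
  rewrite -(inj_eq (mulgI g)) mulKVg; case: eqP => // _.
  by rewrite action0 mulr0.
by move=> t /negPf tg; rewrite !ffunE tg mul0r.
Qed.

Lemma point_mass_star g a : convolution_star alpha (point_mass g a) = point_mass g^-1%g (alpha g^-1%g (star a)).
Proof.
apply/ffunP => s; rewrite !ffunE; case: (eqVneq s g^-1%g) => [->|sg].
  by rewrite invgK eqxx.
by rewrite -(can_eq (@invgK gT)) in sg; rewrite invgK in sg; rewrite (negPf sg) star0 action0.
Qed.

Context (cp : is_crossed_product alpha iota).

(** The canonical copy of [A] in the crossed product. *)
Definition canA a := iota (point_mass 1%g a).
(** The canonical unitaries implementing the action. *)
Definition canU g := iota (point_mass g 1).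

Lemma cp_iota_lin c f k : iota (c *: f + k) = c *: iota f + iota k.
Proof. by have [l _ _ _ _] := cp; rewrite l. Qed.
Lemma cp_iota_mul g a h b : iota (point_mass g a) * iota (point_mass h b) = iota (point_mass (g * h)%g (a * alpha g b)).
Proof. by have [_ l _ _ _] := cp; rewrite -l point_mass_conv. Qed.
Lemma cp_iota_star g a : star (iota (point_mass g a)) = iota (point_mass g^-1%g (alpha g^-1%g (star a))).
Proof. by have [_ _ l _ _] := cp; rewrite -l point_mass_star. Qed.

Lemma canA_lin c a b : canA (c *: a + b) = c *: canA a + canA b.
Proof.
rewrite /canA -cp_iota_lin; congr iota; apply/ffunP => s; rewrite !ffunE.
by case: eqP => // _; rewrite scaler0 addr0.
Qed.
Lemma canAM a b : canA (a * b) = canA a * canA b.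
Proof. by rewrite cp_iota_mul mulg1 action_id. Qed.
Lemma canA_star a : canA (star a) = star (canA a).
Proof. by rewrite cp_iota_star invg1 action_id. Qed.
Lemma canUM g h : canU (g * h)%g = canU g * canU h.
Proof. by rewrite cp_iota_mul action1 mulr1. Qed.
Lemma canU_star g : star (canU g) = canU g^-1%g.
Proof. by rewrite cp_iota_star star1 action1. Qed.
Lemma canU_canA g a : canU g * canA a = canA (alpha g a) * canU g.
Proof. by rewrite !cp_iota_mul mulg1 mul1g mul1r action_id mulr1. Qed.
Lemma canAUE g a : canA a * canU g = iota (point_mass g a).
Proof. by rewrite cp_iota_mul mul1g action_id mulr1. Qed.

Lemma cp_iota0 : iota 0 = 0.
Proof.
have := cp_iota_lin 1 0 0; rewrite !scale1r addr0 => /eqP.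
by rewrite -subr_eq subrr eq_sym => /eqP.
Qed.

Lemma cp_iotaE f : iota f = \sum_g canA (f g) * canU g.
Proof.
under eq_bigr do rewrite canAUE.
have cpD : {morph iota : x y / x + y}.
  by move=> x y; have := cp_iota_lin 1 x y; rewrite !scale1r.
rewrite -(big_morph iota cpD cp_iota0); congr iota; apply/ffunP => s.
rewrite sum_ffunE (bigD1 s) //= ffunE eqxx big1 ?addr0 // => t /negPf ts.
by rewrite ffunE eq_sym ts.
Qed.

Lemma cp_dense x (e : R) : 0 < e -> exists f, nrm (x - iota f) < e.
Proof.
have [_ _ _ _ d] := cp; move/denseP: d => d e0.
by have [y [f _ <-] h] := d x e e0; exists f.
Qed.

(** [canA 1] is a left unit on the dense range of [iota]. *)
Lemma canA1 : canA 1 = 1.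
Proof.
suff h x : canA 1 * x = x by rewrite -(h 1) mulr1.
apply: subr0_eq; apply: nrm_small => e e0.
have K0 : 0 < nrm (canA 1) + 1 by have := nrm_ge0 (canA 1); lra.
have [f xf] := cp_dense x (divr_gt0 e0 K0).
have jf : canA 1 * iota f = iota f.
  rewrite cp_iotaE mulr_sumr; apply: eq_bigr => g _.
  by rewrite mulrA -canAM mul1r.
have -> : canA 1 * x - x = canA 1 * (x - iota f) - (x - iota f).
  by rewrite mulrBr jf; ncring.
rewrite ltr_pdivlMr // in xf.
apply: le_lt_trans (nrm_sub_le (nrmM _ _) (lexx _)) _; lra.
Qed.

Lemma canU1 : canU 1%g = 1. Proof. exact: canA1. Qed.
Lemma canUV g : canU g * canU g^-1%g = 1.
Proof. by rewrite -canUM mulgV canU1. Qed.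

(** The norm of [B] is the least bound over all covariant representations, so
that the uniform bound of [rep_bound] is one for [canA a]. *)
Lemma nrm_canA a : nrm (canA a) <= 2 * nrm a.
Proof.
have [_ _ _ univ _] := cp; have [_ least] := univ (point_mass 1%g a).
have {}least := least (2 * nrm a)%:C.
rewrite -lecR -nrmE; apply: least; split.
  by rewrite ler0c mulr_ge0 ?nrm_ge0.
move=> H pi v [rpi [vlin viso _] _] x.
have -> : integrated_form pi v (point_mass 1%g a) x = pi a (v 1%g x).
  rewrite /integrated_form (bigD1 1%g) //= ffunE eqxx big1 ?addr0 // => g /negPf g1.
  by rewrite ffunE g1 rep0.
have vx : nrm (v 1%g x) = nrm x.
  have := viso 1%g x x; rewrite !inner_nrm => /complexI /eqP.
  by rewrite eqrXn2 ?nrm_ge0 // => /eqP.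
by rewrite !nrmE -rmorphM lecR -vx; apply: rep_bound.
Qed.

End CrossedProductGenerators.

(** * Projections and partial isometries near approximate ones *)

Section Projections.
Context {R : realType} {A : unitalCStarType R}.
Implicit Types (x y e q : A) (d : R) (S : set A).

(** [x] is within [d] of [S]; the infimum defining the distance is avoided. *)
Definition near_set S d x := exists2 t, S t & nrm (x - t) <= d.
(** If [x] in [S] is within [1/2] of [1], the elements [1 - (1 - x) ^+ k] lie in [S]
and converge to [1]. *)
Lemma unital_of_near1 S : is_findim_cstar_subalgebra S -> near_set S (1 / 2) 1 -> unital_findim S.
Proof.
move=> fS [x Sx x1]; split => //.
have [[n [v Sv]] SM _] := fS.
have cS : nclosed S by rewrite Sv; apply: span_nclosed.
have approx k : exists2 z, S z & nrm (1 - z) <= 1 / 2 ^+ k.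
  elim: k => [|k [z Sz z1]].
    by exists 0; [exact: span0 Sv | rewrite subr0 expr0 divr1 nrm1].
  exists (z + x - z * x).
    have DB y w : S y -> S w -> S (y - w).
      by move=> Sy Sw; rewrite -scaleN1r; apply: (spanD Sv) => //; apply: (spanZ Sv).
    by apply: DB; [apply: (spanD Sv) | apply: SM].
  have -> : 1 - (z + x - z * x) = (1 - z) * (1 - x) by ncring.
  by rewrite exprSr invfM mulrA; apply: nrm_mul_le => //; rewrite -[X in _ <= X]mul1r.
apply: cS => d d0; have [k Hk] := div_pow2_small ler01 d0.
have [z Sz z1] := approx k; exists z => //.
exact: le_lt_trans z1 (Hk k (leqnn k)).
Qed.

Lemma sa_near S x e d : unital_findim S -> S x -> star e = e -> nrm (e - x) <= d ->
  exists2 y, S y & star y = y /\ nrm (e - y) <= d.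
Proof.
move=> uS Sx es ex; exists (halfC *: (x + star x)).
  by apply: findimZ => //; apply: findimD => //; apply: findim_star.
split; first by rewrite star_half starD starK addrC.
have -> : e - halfC *: (x + star x) = halfC *: ((e - x) + (star e - star x)).
  rewrite -[in LHS](half2 e) -scalerDr -scalerBr es; congr (_ *: _); ncring.
have := nrmD (e - x) (star e - star x).
by rewrite nrm_half -starB nrm_star; lra.
Qed.

(** A projection corresponds to a symmetry [2 * e - 1].  If [z] in [S] is
self-adjoint and near a symmetry, then [z * (z * z)^(-1/2)] is a symmetry in
[S]. *)
Lemma near_projection S e d : unital_findim S -> is_projection e -> 0 < d -> d <= 1 / 100 ->
  near_set S d e -> exists q, [/\ S q, is_projection q & nrm (q - e) <= 13 * d].
Proof.
move=> uS [ee es] d0 d100 [x0 Sx0 ex0].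
have [x Sx [xs ex]] := sa_near uS Sx0 es ex0.
pose z0 := e + e - 1; pose z := x + x - 1.
have z0z0 : z0 * z0 = 1.
  have -> : z0 * z0 = (e * e + e * e + e * e + e * e) - (e + e + e + e) + 1 by rewrite /z0; ncring.
  by rewrite ee; ncring.
have z0s : star z0 = z0 by rewrite /z0 starB starD star1 es.
have zs : star z = z by rewrite /z starB starD star1 xs.
have z01 : nrm z0 <= 1 by apply: nrm_isom; rewrite z0s z0z0 nrm1.
have zz0 : nrm (z - z0) <= 2 * d.
  have -> : z - z0 = - ((e - x) + (e - x)) by rewrite /z /z0; ncring.
  by rewrite nrmN; have := nrm_add_le ex ex; lra.
have z2 : nrm z <= 2.
  have -> : z = z0 + (z - z0) by ncring.
  by apply: le_trans (nrm_add_le z01 zz0) _; lra.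
have k6 : nrm (z * z - 1) <= 6 * d.
  have -> : z * z - 1 = z * (z - z0) + (z - z0) * z0.
    by rewrite -z0z0; ncring.
  apply: le_trans (nrm_add_le (nrm_mul_le z2 zz0) (nrm_mul_le zz0 z01)) _; lra.
have [||||r [rs rr r1 rcomm rT]] := @inv_sqrt_sa _ A (z * z - 1) (6 * d).
- by rewrite starB starM zs star1.
- by lra.
- by lra.
- by [].
have k1 : 1 + (z * z - 1) = z * z by ncring.
rewrite k1 in rr.
have zr : z * r = r * z by apply: rcomm; ncring.
have Sz : S z by apply: findimB => //; [exact: findimD | exact: findim1].
have Sr : S r by apply: rT => //; apply: findimB => //; [exact: findimM | exact: findim1].
pose w := z * r.
have ww : w * w = 1.
  rewrite -rr; have -> : r * r * (z * z) = r * (r * z) * z by ncring.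
  rewrite -zr; have -> : r * (z * r) * z = (r * z) * (r * z) by ncring.
  by rewrite -zr.
have ws : star w = w by rewrite /w starM rs zs zr.
exists (halfC *: (w + 1)); split.
- by apply: findimZ => //; apply: findimD => //; [exact: findimM | exact: findim1].
- split; last by rewrite star_half starD ws star1.
  rewrite scaleAl scaleAr.
  have -> : (w + 1) * (w + 1) = (w + 1) + (w + 1).
    by rewrite mulrDl mulrDr ww; ncring.
  by rewrite -[in RHS](half2 (w + 1)) scalerDr.
- have -> : halfC *: (w + 1) - e = halfC *: (w - z0).
    by rewrite -[in LHS](half2 e) -scalerDr -scalerBr; congr (_ *: _); rewrite /z0; ncring.
  rewrite nrm_half.
  have : nrm (w - z0) <= 2 * (2 * (6 * d)) + 2 * d.
    have -> : w - z0 = z * (r - 1) + (z - z0) by rewrite /w; ncring.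
    by apply: nrm_add_le => //; apply: nrm_mul_le.
  lra.
Qed.
(** Polar decomposition: [v := y * r] with [r] the inverse square root of
[1 - q + star y * y], which is near [1] in the whole algebra and agrees with
[star y * y] on the corner of [q]. *)
Lemma partial_isometry q y d : is_projection q -> y * q = y -> nrm y <= 1 ->
  0 < d -> d <= 1 / 4 -> nrm (star y * y - q) <= d ->
  exists v, [/\ star v * v = q, v * q = v, nrm (v - y) <= 2 * d
    & forall e, e * y = y -> e * v = v].
Proof.
move=> [qq qs] yq y1 d0 d4 hd; set h := _ - q in hd.
have qy : q * star y = star y by rewrite -[in LHS]qs -starM yq.
have hq : h * q = h by rewrite /h mulrBl -mulrA yq qq.
have qh : q * h = h by rewrite /h mulrBr mulrA qy qq.
have [||||r [rs rr r1 rcomm _]] := @inv_sqrt_sa _ A h d => //.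
  by rewrite /h starB starM starK qs.
have hr : h * r = r * h by apply: rcomm.
have qr : q * r = r * q by apply: rcomm; rewrite hq qh.
exists (y * r); split.
- have yy : star y * y = q * (1 + h) by rewrite mulrDr mulr1 qh /h; ncring.
  have -> : star (y * r) * (y * r) = r * (star y * y) * r.
    by rewrite starM rs; ncring.
  rewrite yy mulrA -qr.
  have -> : q * r * (1 + h) * r = q * (r * r * (1 + h)).
    have -> : q * r * (1 + h) * r = q * r * (r + h * r) by ncring.
    by rewrite hr; ncring.
  by rewrite rr mulr1.
- by rewrite -mulrA -qr mulrA yq.
- have -> : y * r - y = y * (r - 1) by ncring.
  by rewrite -[2 * d]mul1r; apply: nrm_mul_le.
- by move=> e ey; rewrite mulrA ey.
Qed.

End Projections.

(** * Local approximation of the crossed product *)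

Lemma fintype_span (R : realType) (V : lmodType R[i]) (I : finType) (b : I -> V) :
  is_span [set x | exists c : I -> R[i], x = \sum_i c i *: b i]
    (fun k : 'I_#|I| => b (enum_val k)).
Proof.
have reidx (F : I -> V) : \sum_i F i = \sum_(k < #|I|) F (enum_val k).
  rewrite (reindex (@enum_val I I)) //=.
  exact/onW_bij/enum_val_bij.
apply/seteqP; split => [x [c ->]|x [c ->]].
  by exists (fun k => c (enum_val k)); rewrite reidx.
exists (fun i => c (enum_rank i)); rewrite reidx.
by apply: eq_bigr => k _; rewrite enum_valK.
Qed.

Section AFNear.
Context {R : realType} {A : unitalCStarType R}.

Lemma chain_mono (S : nat -> set A) : (forall n, S n `<=` S n.+1) ->
  forall n m, (n <= m)%N -> S n `<=` S m.
Proof.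
move=> SS n m /subnKC <-; elim: (m - n)%N => [|k IH]; first by rewrite addn0.
by rewrite addnS => x /IH; apply: SS.
Qed.

Lemma AF_near : is_AF A -> forall (I : finType) (F : I -> A) (d : R), 0 < d ->
  exists2 S : set A, unital_findim S & forall i, near_set S d (F i).
Proof.
move=> [S [fS SS /denseP dS]] I F d d0.
have dS' x (e : R) : 0 < e -> exists n, near_set (S n) e x.
  move=> e0; have [y [n _ Sy] xy] := dS x e e0.
  by exists n, y => //; exact: ltW.
have /choice[n nP] i : exists n, near_set (S n) d (F i) by apply: dS'.
have [|n1 n1P] := dS' 1 (1 / 2); first by lra.
pose N := maxn n1 (\max_i n i).
have mono x e m : (m <= N)%N -> near_set (S m) e x -> near_set (S N) e x.
  by move=> mN [t St xt]; exists t => //; apply: chain_mono St.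
exists (S N).
  by apply: unital_of_near1 => //; apply: mono n1P; rewrite leq_maxl.
move=> i; apply: mono (nP i); apply: leq_trans (leq_maxr _ _).
exact: (leq_bigmax i).
Qed.

Lemma fin_bound (I : finType) (F : I -> A) : exists2 M : R, 1 <= M & forall i, nrm (F i) <= M.
Proof.
exists (1 + \sum_i nrm (F i)).
  by rewrite lerDl sumr_ge0 // => i _; exact: nrm_ge0.
move=> i; rewrite (bigD1 i) //= addrCA lerDl addr_ge0 // sumr_ge0 // => j _.
exact: nrm_ge0.
Qed.

Lemma nrm_sum_fin (I : finType) (F : I -> A) (M : R) :
  (forall i, nrm (F i) <= M) -> nrm (\sum_i F i) <= #|I|%:R * M.
Proof.
move=> FM; apply: le_trans (nrm_sum _ _ _) _.
by apply: le_trans (ler_sum _ (fun i _ => FM i)) _; rewrite sumr_const mulr_natl.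
Qed.

End AFNear.

Section LocalApproximation.
Context {R : realType} {gT : finGroupType} {A : unitalCStarType R}.
Context (alpha : gT -> A -> A) (B : unitalCStarType R) (iota : {ffun gT -> A} -> B).
Context (act : is_cstar_action alpha).
Context (cp : is_crossed_product alpha iota).
Context (rok : strict_Rokhlin alpha).
Context (af : is_AF A).

Local Notation j := (canA iota).
Local Notation u := (canU iota).

Lemma canA0 : j 0 = 0.
Proof.
have := canA_lin cp 1 0 0; rewrite !scale1r addr0 => /eqP.
by rewrite -subr_eq subrr eq_sym => /eqP.
Qed.
Lemma canAD a b : j (a + b) = j a + j b.
Proof. by have := canA_lin cp 1 a b; rewrite !scale1r. Qed.
Lemma canAZ c a : j (c *: a) = c *: j a.
Proof. by have := canA_lin cp c a 0; rewrite canA0 !addr0. Qed.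
Lemma canAB a b : j (a - b) = j a - j b.
Proof. by rewrite -scaleN1r canAD canAZ scaleN1r. Qed.
Lemma canA_sum (I : Type) (r : seq I) (P : pred I) (F : I -> A) :
  j (\sum_(i <- r | P i) F i) = \sum_(i <- r | P i) j (F i).
Proof. exact: (big_morph j canAD canA0). Qed.

Lemma canA_proj p : is_projection p -> is_projection (j p).
Proof. by move=> [pp ps]; split; rewrite -?(canAM act cp) -?(canA_star act cp) ?pp ?ps. Qed.

Lemma nrm_canU g : nrm (u g) <= 1.
Proof. by apply: nrm_isom; rewrite (canU_star act cp) -(canUM act cp) mulVg (canU1 act cp) nrm1. Qed.

Lemma action_proj g p : is_projection p -> is_projection (alpha g p).
Proof.
move=> [pp ps]; split; first by rewrite -(actionM act) pp.
by rewrite -(action_star act) ps.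
Qed.
(** Since [star (v g) * v h] is [q] or [0], the elements [v g * star (v h)] multiply
like matrix units and products of coefficients pick up a factor [q] from [S]. *)
Lemma corner_algebra (S : set A) (q : A) (v : gT -> B) : unital_findim S -> S q ->
  (forall g h, star (v g) * v h = if g == h then j q else 0) ->
  is_findim_cstar_subalgebra
    [set x | exists X : gT -> gT -> A, (forall g h, S (X g h)) /\
       x = \sum_g \sum_h v g * j (X g h) * star (v h)].
Proof.
move=> uS Sq vv; have [[[n [b Sb]] _ _] _] := uS.
split.
- pose bb (p : gT * gT * 'I_n) := v p.1.1 * j (b p.2) * star (v p.1.2).
  have sumE (c : gT * gT * 'I_n -> R[i]) : \sum_p c p *: bb p =
      \sum_g \sum_h v g * j (\sum_i c (g, h, i) *: b i) * star (v h).
    rewrite (eq_bigr (fun p => c (p.1, p.2) *: bb (p.1, p.2))); last by case.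
    rewrite -(pair_bigA _ (fun p i => c (p, i) *: bb (p, i))) /=.
    rewrite (eq_bigr (fun p => \sum_i c (p.1, p.2, i) *: bb (p.1, p.2, i))); last by case.
    rewrite -(pair_bigA _ (fun g h => \sum_i c (g, h, i) *: bb (g, h, i))) /=.
    apply: eq_bigr => g _; apply: eq_bigr => h _.
    rewrite canA_sum mulr_sumr mulr_suml; apply: eq_bigr => i _.
    by rewrite canAZ scaleAr scaleAl.
  suff -> : [set x | exists X : gT -> gT -> A, (forall g h, S (X g h)) /\
       x = \sum_g \sum_h v g * j (X g h) * star (v h)] =
     [set x | exists c : gT * gT * 'I_n -> R[i], x = \sum_p c p *: bb p].
    by do 2!eexists; apply: fintype_span.
  apply/seteqP; split => [x [X [SX ->]]|x [c ->]] /=; last first.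
    rewrite sumE; eexists; split; last reflexivity.
    by move=> g h; apply: findim_sum => // i _; apply: findimZ => //; apply: span_gen Sb i.
  have /choice[c cP] (p : gT * gT) : exists c : 'I_n -> R[i], X p.1 p.2 = \sum_i c i *: b i.
    by have := SX p.1 p.2; rewrite {1}Sb.
  exists (fun p => c p.1 p.2); rewrite sumE.
  by apply: eq_bigr => g _; apply: eq_bigr => h _; rewrite -(cP (g, h)).
- move=> x y [X [SX ->]] [Y [SY ->]].
  exists (fun g l => \sum_h X g h * q * Y h l); split.
    by move=> g l; apply: findim_sum => // h _; apply: findimM => //; apply: findimM.
  rewrite mulr_suml; apply: eq_bigr => g _; rewrite mulr_suml.
  transitivity (\sum_h \sum_l v g * j (X g h * q * Y h l) * star (v l)).
    apply: eq_bigr => h _; rewrite mulr_sumr (bigD1 h) //= [X in _ + X]big1 ?addr0.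
      rewrite mulr_sumr; apply: eq_bigr => l _.
      rewrite !(canAM act cp).
      have := vv h h; rewrite eqxx => <-; ncring.
    move=> k /negPf kh; rewrite mulr_sumr big1 // => l _.
    have -> : v g * j (X g h) * star (v h) * (v k * j (Y k l) * star (v l)) =
      v g * j (X g h) * (star (v h) * v k) * (j (Y k l) * star (v l)) by ncring.
    by rewrite vv eq_sym kh mulr0 mul0r.
  rewrite exchange_big /=; apply: eq_bigr => l _.
  by rewrite canA_sum mulr_sumr mulr_suml.
- move=> x [X [SX ->]]; exists (fun g h => star (X h g)); split.
    by move=> g h; apply: findim_star.
  rewrite star_sum; under eq_bigr do rewrite star_sum.
  rewrite exchange_big /=; apply: eq_bigr => g _; apply: eq_bigr => h _.
  by rewrite !starM starK -(canA_star act cp) mulrA.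
Qed.

(** Perturbation of the three factors of [w * t * star w']. *)
Lemma sandwich_near (v w s t : B) (K d : R) : nrm v <= 1 -> nrm w <= 1 ->
  forall v' w' : B, nrm v' <= 1 -> nrm w' <= 1 -> nrm (v - w) <= d -> nrm (v' - w') <= d ->
  nrm s <= K -> nrm t <= K -> nrm (s - t) <= d -> 
  nrm (w * t * star w' - v * s * star v') <= (2 * K + 1) * d.
Proof.
move=> v1 w1 v' w' v'1 w'1 vw v'w' sK tK st.
have d0 : 0 <= d := le_trans (nrm_ge0 _) vw.
have -> : w * t * star w' - v * s * star v' =
  - ((v - w) * s * star v' + w * (s - t) * star v' + w * t * star (v' - w')).
  by rewrite starB; ncring.
rewrite nrmN.
have -> : (2 * K + 1) * d = d * K * 1 + 1 * d * 1 + 1 * K * d by ring.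
by do !(apply: nrm_add_le || apply: nrm_mul_le) => //; rewrite nrm_star.
Qed.

(** Let [w g := u g * e 1] with Rokhlin projections [e], and let [v g] be the
polar part of [e g * u g * q], where [q] is a projection of a finite-dimensional
[S] close to [e 1].  Conjugating by [u g] shows
[star (e g * u g * q) * (e g * u g * q) = q * alpha g^-1 (e g) * q], which is close
to [q]; and the [v g] have orthogonal ranges because [v g = e g * v g].  On the
other hand [w g * alpha g^-1 a * star (w g)] equals
[alpha g (e 1) * a * alpha g (e 1)], close to [e g * a], and the sum of the [e g] is
[1]. *)
Lemma local_generators (I : finType) (F : I -> A) (eps : R) : 0 < eps ->
  exists2 D : set B, unital_findim D &
    (forall i, near_set D eps (j (F i))) /\ (forall g, near_set D eps (u g)).
Proof.
move=> eps0.
have [K K1 KP] := fin_bound (fun p : gT * I => alpha p.1 (F p.2)).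
have FK i : nrm (F i) <= K by rewrite -[F i](action_id act); exact: (KP (1%g, i)).
pose N : R := #|gT|%:R.
have N1 : 1 <= N by rewrite ler1n; apply/card_gt0P; exists 1%g.
have N0 : 0 < N by lra.
have K0 : 0 < K by lra.
pose eps1 := Num.min eps (1 / 2).
(* Each of the [N] terms of a sum will cost at most [1000 * K * d]; the bound
   [1 / 2] makes the approximating algebra unital. *)
pose d := eps1 / (1000 * (N * K)).
have NK1 : 1 <= N * K by rewrite -[1]mulr1 ler_pM.
have m0 : 0 < eps1 by rewrite lt_min eps0 divr_gt0.
have D0 : 0 < 1000 * (N * K) by lra.
have d0 : 0 < d by rewrite divr_gt0.
have dE : d * (1000 * (N * K)) = eps1 by apply: divfK; exact: lt0r_neq0.
have deps : 1000 * (N * (K * d)) <= eps1.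
  rewrite (_ : 1000 * (N * (K * d)) = d * (1000 * (N * K))); last by ring.
  by rewrite dE.
have d1 : 1000 * d <= 1.
  apply: le_trans (_ : d * (1000 * (N * K)) <= _); last first.
    by rewrite dE /eps1 ge_min; apply/orP; right; lra.
  have : d <= d * (N * K) by rewrite ler_peMr // ltW.
  lra.
have dC : 0 < d%:C by rewrite ltcR.
have [e [[ep eo] ea ec e1]] := rok (finite_image F (@finite_finset I setT)) dC.
have [S uS Snear] := AF_near af (fun o : option (gT * I) =>
  if o is Some p then alpha p.1^-1%g (F p.2) else e 1%g) d0.
have [|q [Sq qp qe]] := near_projection uS (ep 1%g) d0 _ (Snear None); first by lra.
have act_e g h : nrm (alpha g (e h) - e (g * h)%g) <= d.
  by apply: ltW; rewrite -nrm_lt; apply: ea.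
have comm_e g i : nrm (e g * F i - F i * e g) <= d.
  by apply: ltW; rewrite -nrm_lt; apply: ec; exists i.
have proj1 (p : A) : is_projection p -> nrm p <= 1 by case=> pp ps; apply: nrm_proj.
have en g : nrm (e g) <= 1 := proj1 _ (ep g).
have q1 : nrm q <= 1 := proj1 _ qp.
have proj1B (p : B) : is_projection p -> nrm p <= 1 by case=> pp ps; apply: nrm_proj.
have jn (a : A) M : nrm a <= M -> nrm (j a) <= 2 * M.
  by move=> aM; apply: le_trans (nrm_canA cp a) _; rewrite ler_pM2l.
have je g : nrm (j (e g)) <= 1 by apply: proj1B; apply: canA_proj.
(* The approximate first column of matrix units; [exv] makes it exact. *)
pose w g := u g * j (e 1%g).
have w1 g : nrm (w g) <= 1 by rewrite -[1]mulr1; apply: nrm_mul_le; rewrite ?nrm_canU.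
have exv g : exists v : B, [/\ star v * v = j q, nrm (v - w g) <= 84 * d & j (e g) * v = v].
  pose y := j (e g) * u g * j q.
  have [qq qs] := canA_proj qp.
  pose f := alpha g^-1%g (e g).
  have fp : is_projection f by apply: action_proj.
  have fn : nrm f <= 1 := proj1 _ fp.
  have fe : nrm (f - e 1%g) <= d by have := act_e g^-1%g g; rewrite mulVg.
  have yE : y = u g * j (f * q).
    rewrite (canAM act cp) mulrA (canU_canA act cp); congr (_ * _ * _).
    by rewrite /f -(action_comp act) mulgV (action_id act).
  have y1 : nrm y <= 1.
    rewrite -[1]mulr1; apply: nrm_mul_le; last by apply: proj1B.
    by rewrite -[1]mulr1; apply: nrm_mul_le; rewrite ?nrm_canU.
  have yy : star y * y = j (q * f * q).
    rewrite yE starM (canU_star act cp) -(canA_star act cp) starM qp.2 fp.2.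
    have -> : j (q * f) * u g^-1%g * (u g * j (f * q)) =
      j (q * f) * (u g^-1%g * u g) * j (f * q) by ncring.
    rewrite -(canUM act cp) mulVg (canU1 act cp) mulr1 -(canAM act cp); congr j.
    by rewrite mulrA -(mulrA q f f) fp.1.
  have [||||v [vv vq vy ve]] := @partial_isometry _ B (j q) y (28 * d) (canA_proj qp) _ y1.
  - by rewrite /y -mulrA qq.
  - by lra.
  - by lra.
  - rewrite yy -canAB; have -> : q * f * q - q = q * (f - q) * q.
      by rewrite mulrBr mulrBl !qp.1.
    have fq : nrm (f - q) <= d + 13 * d.
      have -> : f - q = (f - e 1%g) - (q - e 1%g) by ncring.
      exact: nrm_sub_le.
    rewrite (_ : 28 * d = 2 * (1 * (d + 13 * d) * 1)); last by ring.
    by apply: jn; do 2!(apply: nrm_mul_le => //).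
  exists v; split => //.
  - have -> : v - w g = (v - y) + u g * j (f * q - e 1%g).
      by rewrite canAB yE /w; ncring.
    rewrite (_ : 84 * d = 2 * (28 * d) + 1 * (2 * (d * 1 + 1 * (13 * d)))); last by ring.
    apply: nrm_add_le => //; apply: nrm_mul_le; first exact: nrm_canU.
    apply: jn; have -> : f * q - e 1%g = (f - e 1%g) * q + e 1%g * (q - e 1%g).
      by rewrite -[in LHS](ep 1%g).1; ncring.
    by apply: nrm_add_le; apply: nrm_mul_le.
  - apply: ve; rewrite /y !mulrA -(canAM act cp); by rewrite (ep g).1.
have /choice[v vP] := exv.
have vv g h : star (v g) * v h = if g == h then j q else 0.
  case: eqP => [->|gh]; first by have [] := vP h.
  have [_ _ <-] := vP h; have [_ _ {1}<-] := vP g.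
  rewrite starM -(canA_star act cp) (ep g).2.
  have -> : star (v g) * j (e g) * (j (e h) * v h) = star (v g) * (j (e g) * j (e h)) * v h by ncring.
  by rewrite -(canAM act cp) eo // canA0 mulr0 mul0r.
have v1 g : nrm (v g) <= 1.
  by apply: nrm_isom; rewrite vv eqxx; apply: proj1B; apply: canA_proj.
have vw g : nrm (v g - w g) <= 84 * d by have [] := vP g.
have fD := corner_algebra uS Sq vv.
set D := [set x | _] in fD.
have DI g h s : S s -> D (v g * j s * star (v h)).
  move=> Ss; exists (fun g' h' => if (g' == g) && (h' == h) then s else 0); split.
    by move=> g' h'; case: ifP => // _; exact: findim0.
  rewrite (bigD1 g) //= (bigD1 h) //= !eqxx /= big1 => [|h' /negPf h'h]; last first.
    by rewrite h'h canA0 mulr0 mul0r.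
  rewrite big1 ?addr0 // => g' /negPf g'g; rewrite big1 // => h' _.
  by rewrite g'g canA0 mulr0 mul0r.
have Dsum (E : gT -> B) : (forall g, D (E g)) -> D (\sum_g E g).
  move=> DE; have [[m [b Db]] _ _] := fD.
  by elim/big_ind: _ => //; [exact: span0 Db | exact: spanD Db].
have [c cE] : exists c, c = 1000 * K by eexists.
have near_sum (E E' : gT -> B) : (forall g, D (E' g)) ->
    (forall g, nrm (E g - E' g) <= c * d) -> near_set D eps1 (\sum_g E g).
  move=> DE' EE'; exists (\sum_g E' g); first exact: Dsum.
  rewrite -sumrB; apply: le_trans (nrm_sum_fin EE') _.
  by apply: le_trans deps; rewrite -/N cE (_ : 1000 * (N * (K * d)) = N * (1000 * K * d)); last by ring.
have f1 g : nrm (alpha g (e 1%g) - e g) <= d by have := act_e g 1%g; rewrite mulg1.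
have wE g a : w g * j a * star (w g) = j (alpha g (e 1%g * a * e 1%g)).
  have -> : w g * j a * star (w g) = u g * j (e 1%g * a * e 1%g) * u g^-1%g.
    rewrite /w starM (canU_star act cp) -(canA_star act cp) (ep 1%g).2 !(canAM act cp); ncring.
  by rewrite (canU_canA act cp) -mulrA (canUV act cp) mulr1.
have nearj i : near_set D eps1 (j (F i)).
  have /choice[s sP] g : exists s, S s /\ nrm (alpha g^-1%g (F i) - s) <= d.
    by have [s Ss h] := Snear (Some (g, i)); exists s.
  have -> : j (F i) = \sum_g j (e g * F i) by rewrite -canA_sum -mulr_suml e1 mul1r.
  apply: (near_sum _ (fun g => v g * j (s g) * star (v g))) => g.
    by apply: DI; exact: (sP g).1.
  pose a' := alpha g^-1%g (F i); pose f := alpha g (e 1%g).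
  have fp : is_projection f by apply: action_proj.
  have fn : nrm f <= 1 := proj1 _ fp.
  have fd : nrm (f - e g) <= d := f1 g.
  have a'K : nrm a' <= K := KP (g^-1%g, i).
  have sK : nrm (s g) <= K + d.
    have -> : s g = a' - (a' - s g) by ncring.
    by apply: nrm_sub_le => //; exact: (sP g).2.
  have wf : w g * j a' * star (w g) = j (f * F i * f).
    by rewrite wE !(actionM act) /a' -(action_comp act) mulgV (action_id act).
  have -> : j (e g * F i) - v g * j (s g) * star (v g) =
    j (e g * F i - f * F i * f) + (w g * j a' * star (w g) - v g * j (s g) * star (v g)).
    by rewrite wf canAB; ncring.
  have t1 : nrm (j (e g * F i - f * F i * f)) <= 2 * (d + (1 * K * d + d * K * 1)).
    apply: jn.
    have -> : e g * F i - f * F i * f = e g * (e g * F i - F i * e g) -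
      (e g * F i * (f - e g) + (f - e g) * F i * f).
      by rewrite -{1}(ep g).1; ncring.
    apply: nrm_sub_le; first by rewrite -[d]mul1r; apply: nrm_mul_le.
    by apply: nrm_add_le; do 2!(apply: nrm_mul_le => //).
  have t2 : nrm (w g * j a' * star (w g) - v g * j (s g) * star (v g)) <=
      (2 * (2 * (K + d)) + 1) * (84 * d).
    apply: sandwich_near => //.
    - exact: jn.
    - by apply: jn; apply: le_trans a'K _; lra.
    - rewrite -canAB; apply: le_trans (_ : 2 * d <= _); last by lra.
      by apply: jn; rewrite nrmB; exact: (sP g).2.
  apply: le_trans (nrm_add_le t1 t2) _.
  have Kd0 : 0 < K * d by rewrite mulr_gt0.
  have dKd : d <= K * d by rewrite ler_peMl // ltW.
  have dd : d * d <= d * (1 / 1000) by rewrite ler_pM2l //; lra.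
  rewrite cE; lra.
have nearu h : near_set D eps1 (u h).
  have -> : u h = \sum_g u h * j (e g) by rewrite -mulr_sumr -canA_sum e1 (canA1 act cp) mulr1.
  apply: (near_sum _ (fun g => v (h * g)%g * j 1 * star (v g))) => g.
    by apply: DI; exact: findim1.
  have -> : u h * j (e g) - v (h * g)%g * j 1 * star (v g) =
    u h * j (e g - alpha g (e 1%g)) + (w (h * g)%g * j 1 * star (w g) - v (h * g)%g * j 1 * star (v g)).
    have -> : w (h * g)%g * j 1 * star (w g) = u h * (w g * j 1 * star (w g)).
      by rewrite /w (canUM act cp); ncring.
    by rewrite wE mulr1 (ep 1%g).1 canAB; ncring.
  apply: le_trans (_ : _ <= 1 * (2 * d) + (2 * 1 + 1) * (84 * d)) _; last first.
    have dKd : d <= K * d by rewrite ler_peMl // ltW.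
    by rewrite cE; lra.
  apply: nrm_add_le.
    by apply: nrm_mul_le; [exact: nrm_canU | apply: jn; rewrite nrmB].
  apply: sandwich_near => //; rewrite ?(canA1 act cp) ?nrm1 // subrr nrm0; lra.
have weaken M x : eps1 <= M -> near_set D eps1 x -> near_set D M x.
  by move=> eM [t Dt xt]; exists t => //; apply: le_trans eM.
exists D; last by split=> ?; apply: weaken => //; rewrite /eps1 ge_min lexx.
apply: unital_of_near1 => //; rewrite -(canU1 act cp); apply: weaken => //.
by rewrite /eps1 ge_min lexx orbT.
Qed.

End LocalApproximation.

(** * From local approximation to a chain *)

Section LocallyAF.
Context {R : realType} {B : unitalCStarType R}.

Definition locally_findim := forall (I : finType) (F : I -> B) (e : R), 0 < e ->
  exists2 T : set B, unital_findim T & forall i, near_set T e (F i).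

Lemma unital_findim_conj (T : set B) (U : B) : star U * U = 1 -> U * star U = 1 -> unital_findim T ->
  unital_findim [set x | T (U * x * star U)].
Proof.
move=> UU UU' uT; have [[[n [v Tv]] _ _] _] := uT.
split; first split.
- exists n, (fun i => star U * v i * U); apply/seteqP; split => [x /=|x [c ->] /=].
    rewrite {1}Tv => -[c cE]; exists c.
    have -> : x = star U * (U * x * star U) * U.
      have -> : star U * (U * x * star U) * U = (star U * U) * x * (star U * U) by ncring.
      by rewrite UU mul1r mulr1.
    rewrite cE mulr_sumr mulr_suml; apply: eq_bigr => i _.
    by rewrite scaleAr scaleAl.
  rewrite mulr_sumr mulr_suml; apply: findim_sum => // i _.
  rewrite scaleAr scaleAl; apply: findimZ => //.
  have -> : U * (star U * v i * U) * star U = (U * star U) * v i * (U * star U) by ncring.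
  by rewrite UU' mul1r mulr1; apply: span_gen Tv i.
- move=> x y /= Tx Ty.
  have -> : U * (x * y) * star U = (U * x * star U) * (U * y * star U).
    have -> : (U * x * star U) * (U * y * star U) = U * x * (star U * U) * y * star U by ncring.
    by rewrite UU mulr1; ncring.
  exact: findimM.
- move=> x /= Tx; have -> : U * star x * star U = star (U * x * star U).
    by rewrite !starM starK mulrA.
  exact: findim_star.
- by rewrite /= mulr1 UU'; apply: findim1.
Qed.

(** Approximate the given family together with a basis of [S], then conjugate the
approximating algebra by a unitary near [1] so that it contains [S]. *)
Lemma locally_findim_extend : locally_findim -> forall (S : set B), unital_findim S ->
  forall (I : finType) (F : I -> B) (e : R), 0 < e ->
  exists2 T : set B, unital_findim T & S `<=` T /\ forall i, near_set T e (F i).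
Proof.
move=> loc S uS I F e e0.
have [m [a [L [Sa L0 near]]]] := near_inclusion uS.
have [K K1 FK] := fin_bound F.
have K0 : 0 < K by lra.
pose e1 := Num.min e 1.
have e10 : 0 < e1 by rewrite lt_min e0 ltr01.
have e11 : e1 <= 1 by rewrite ge_min lexx orbT.
have D0 : 0 < 1 + 5 * (K * L) by rewrite addr_gt0 // !mulr_gt0.
pose d := e1 / (1 + 5 * (K * L)).
have d0 : 0 < d by rewrite divr_gt0.
have dE : d * (1 + 5 * (K * L)) = e1 by apply: divfK; exact: lt0r_neq0.
have Ld0 : 0 < L * d by rewrite mulr_gt0.
have KLd : L * d <= K * (L * d) by rewrite ler_peMl // ltW.
have dE' : d + 5 * (K * (L * d)) = e1 by rewrite -dE; ring.
have [T0 uT0 nT0] := loc _ (fun o : 'I_m + I => match o with inl k => a k | inr i => F i end) d d0.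
have [||U [UU UU' U1 UT]] := near d T0 d0 _ uT0 _.
- by lra.
- by move=> k; exact: nT0 (inl k).
exists [set x | T0 (U * x * star U)]; first exact: unital_findim_conj.
split => // i; have [t Tt it] := nT0 (inr i).
exists (star U * t * U).
  rewrite /=; have -> : U * (star U * t * U) * star U = (U * star U) * t * (U * star U) by ncring.
  by rewrite UU' mul1r mulr1.
have Un : nrm (star U) <= 1 by rewrite nrm_star; apply: nrm_isom; rewrite UU nrm1.
have tK : nrm t <= K + 1.
  have -> : t = F i - (F i - t) by ncring.
  by apply: nrm_sub_le => //; lra.
have -> : F i - star U * t * U = (F i - t) - star U * (t * (U - 1) - (U - 1) * t).
  have -> : star U * (t * (U - 1) - (U - 1) * t) = star U * t * U - (star U * U) * t by ncring.
  by rewrite UU mul1r; ncring.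
apply: le_trans (_ : _ <= d + 1 * ((K + 1) * (L * d) + (L * d) * (K + 1))) _.
  by apply: nrm_sub_le => //; apply: nrm_mul_le => //; apply: nrm_sub_le; apply: nrm_mul_le.
apply: le_trans (_ : e1 <= _); last by rewrite ge_min lexx.
rewrite -dE'; lra.
Qed.

(** Stage [m] of the chain contains the previous one and approximates the
families [b n], [n <= m], within [1 / (m + 1)]: a fixed linear combination of a
fixed family is then approximated as closely as desired at late stages. *)
Lemma locally_findim_AF (I : nat -> finType) (b : forall n, I n -> B) :
  (forall x (e : R), 0 < e -> exists n (c : I n -> R[i]), nrm (x - \sum_i c i *: b n i) < e) ->
  locally_findim -> is_AF B.
Proof.
move=> sep loc.
pose J m := {n : 'I_m.+1 & I n}.
pose F m (p : J m) : B := b (tag p) (tagged p).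
pose eps m : R := m.+1%:R^-1.
have eps0 m : 0 < eps m by rewrite invr_gt0 ltr0n.
have [T0 uT0 _] := loc _ (fun v : void => match v with end) 1 ltr01.
pose FD := {S : set B | unital_findim S}.
have ext m (S : FD) : exists T : FD, sval S `<=` sval T /\ forall p, near_set (sval T) (eps m) (F m p).
  have [T uT h] := locally_findim_extend loc (svalP S) (F m) (eps0 m).
  by exists (exist _ T uT).
have /choice[nx nxP] (p : nat * FD) : exists T : FD, sval p.2 `<=` sval T /\
    forall i, near_set (sval T) (eps p.1) (F p.1 i) by apply: ext.
pose T := fix T n : FD := if n is m.+1 then nx (m, T m) else exist _ T0 uT0.
exists (fun n => sval (T n)); split.
- by move=> n; have [] := svalP (T n).
- by move=> n; exact: (nxP (n, T n)).1.
apply/denseP => x e e0.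
have [n [c xc]] := sep x (e / 2) ltac:(lra).
pose C := \sum_i cabs (c i).
have C0 : 0 <= C by rewrite sumr_ge0 // => i _; exact: cabs_ge0.
have C10 : 0 < 2 * (C + 1) by lra.
have [k kP] : exists k, (C + 1) * eps k <= e / 2.
  have h : 0 <= 2 * (C + 1) / e by rewrite divr_ge0 // ltW.
  have := archi_boundP h; set M := Num.bound _ => h1; exists M.
  rewrite ler_pdivrMr ?ltr0n //.
  rewrite ltr_pdivrMr // in h1.
  rewrite -[M.+1%:R]natr1; lra.
pose m := maxn n k.
have em : (C + 1) * eps m <= e / 2.
  apply: le_trans kP; rewrite ler_pM2l; last by lra.
  by rewrite lef_pV2 ?posrE ?ltr0n // ler_nat ltnS leq_maxr.
have nm : (n < m.+1)%N by rewrite ltnS leq_maxl.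
have near i : near_set (sval (T m.+1)) (eps m) (b n i).
  exact: (nxP (m, T m)).2 (existT _ (Ordinal nm) i).
have /choice[t tP] i : exists t, sval (T m.+1) t /\ nrm (b n i - t) <= eps m.
  by have [t Tt bt] := near i; exists t.
exists (\sum_i c i *: t i).
  exists m.+1 => //; apply: (findim_sum (svalP (T m.+1))) => i _.
  by apply: (findimZ (svalP (T m.+1))); exact: (tP i).1.
apply: le_lt_trans (nrm_tri (\sum_i c i *: b n i) _ _) _.
have : nrm (\sum_i c i *: b n i - \sum_i c i *: t i) <= C * eps m.
  rewrite -sumrB; apply: le_trans (nrm_sum _ _ _) _.
  rewrite mulr_suml; apply: ler_sum => i _.
  rewrite -scalerBr nrmZ; apply: ler_wpM2l; first exact: cabs_ge0.
  exact: (tP i).2.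
have := eps0 m; lra.
Qed.

End LocallyAF.

(** * The crossed product is AF *)

Section CrossedProductAF.
Context {R : realType} {gT : finGroupType} {A : unitalCStarType R}.
Context (alpha : gT -> A -> A) (B : unitalCStarType R) (iota : {ffun gT -> A} -> B).
Context (act : is_cstar_action alpha).
Context (cp : is_crossed_product alpha iota).
Context (af : is_AF A).

Local Notation j := (canA iota).
Local Notation u := (canU iota).

(** Every element is close to a finite sum of products of generators, so it
suffices to approximate the generators well enough. *)
Lemma crossed_product_locally_findim : strict_Rokhlin alpha -> @locally_findim R B.
Proof.
move=> rok I F e e0.
have /choice[f fP] i : exists f, nrm (F i - iota f) < e / 2.
  by apply: (cp_dense cp); lra.
have [K K1 KP] := fin_bound (fun p : I * gT => j (f p.1 p.2)).
have K0 : 0 < K by lra.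
pose N : R := #|gT|%:R.
have N0 : 0 < N by rewrite ltr0n; apply/card_gt0P; exists 1%g.
have D0 : 0 < 6 * (K * N) by rewrite !mulr_gt0.
have m0 : 0 < Num.min (e / (6 * (K * N))) 1 by rewrite lt_min ltr01 divr_gt0.
have [T uT [nj nu]] := local_generators act cp rok af (fun p : I * gT => f p.1 p.2) m0.
set d := Num.min _ _ in m0 nj nu.
have d1 : d <= 1 by rewrite ge_min lexx orbT.
have dK : 6 * (K * N) * d <= e.
  by rewrite mulrC -ler_pdivlMr // ge_min lexx.
have /choice[tj tjP] p : exists t, T t /\ nrm (j (f p.1 p.2) - t) <= d.
  by have [t Tt h] := nj p; exists t.
have /choice[tu tuP] g : exists t, T t /\ nrm (u g - t) <= d.
  by have [t Tt h] := nu g; exists t.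
exists T => // i; exists (\sum_g tj (i, g) * tu g).
  by apply: findim_sum => // g _; apply: findimM => //; [exact: (tjP (i, g)).1 | exact: (tuP g).1].
apply: le_trans (nrm_tri (iota (f i)) _ _) _.
have h1 := fP i.
have h2 : nrm (iota (f i) - \sum_g tj (i, g) * tu g) <= N * (K * d + d * (1 + d)).
  rewrite (cp_iotaE act cp) -sumrB; apply: nrm_sum_fin => g.
  have -> : j (f i g) * u g - tj (i, g) * tu g =
    j (f i g) * (u g - tu g) + (j (f i g) - tj (i, g)) * tu g by ncring.
  apply: nrm_add_le; apply: nrm_mul_le; [exact: (KP (i, g))|exact: (tuP g).2|exact: (tjP (i, g)).2|].
  have -> : tu g = u g - (u g - tu g) by ncring.
  by apply: nrm_sub_le; [exact: nrm_canU act cp g | exact: (tuP g).2].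
have h3 : d * (1 + d) <= d * (2 * K) by rewrite ler_pM2l //; lra.
have h4 : N * (K * d + d * (1 + d)) <= N * (3 * (K * d)).
  by rewrite ler_pM2l //; lra.
have h5 : N * (3 * (K * d)) = (6 * (K * N) * d) / 2 by field.
lra.
Qed.

(** The families are the products of spanning families of the finite-dimensional
algebras of [A] with the canonical unitaries. *)
Lemma crossed_product_separable : exists (I : nat -> finType) (b : forall n, I n -> B),
  forall x (e : R), 0 < e -> exists n (c : I n -> R[i]), nrm (x - \sum_i c i *: b n i) < e.
Proof.
have [S [fS SS /denseP dS]] := af.
have /choice[k kP] n : exists k, exists v : 'I_k -> A, is_span (S n) v.
  by have [[k [v Sv]] _ _] := fS n; exists k, v.
pose v n := projT1 (cid (kP n)).
have Sv n : is_span (S n) (v n) by rewrite /v; case: cid.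
exists (fun n => ('I_(k n) * gT)%type), (fun n p => j (v n p.1) * u p.2) => x e e0.
have [f xf] := cp_dense cp x (ltac:(lra) : 0 < e / 2).
pose N : R := #|gT|%:R.
have N0 : 0 < N by rewrite ltr0n; apply/card_gt0P; exists 1%g.
have d0 : 0 < e / (4 * N) by rewrite divr_gt0 // mulr_gt0.
have /choice[s sP] g : exists s, (exists n, S n s) /\ nrm (f g - s) < e / (4 * N).
  by have [s [n _ Ss] h] := dS (f g) _ d0; exists s; split => //; exists n.
have /choice[n nP] g : exists n, S n (s g) := (sP g).1.
pose m := \max_g n g.
have Ss g : S m (s g) by apply: (chain_mono SS) (nP g); exact: (leq_bigmax g).
have /choice[c cE] g : exists c : 'I_(k m) -> R[i], s g = \sum_i c i *: v m i.
  by have := Ss g; rewrite {1}(Sv m).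
exists m, (fun p => c p.2 p.1).
have -> : \sum_(p : 'I_(k m) * gT) c p.2 p.1 *: (j (v m p.1) * u p.2) = \sum_g j (s g) * u g.
  rewrite -(pair_bigA _ (fun i g => c g i *: (j (v m i) * u g))) /= exchange_big /=.
  apply: eq_bigr => g _; rewrite cE (canA_sum cp) mulr_suml; apply: eq_bigr => i _.
  by rewrite (canAZ cp) scaleAl.
apply: le_lt_trans (nrm_tri (iota f) _ _) _.
have : nrm (iota f - \sum_g j (s g) * u g) <= N * (2 * (e / (4 * N)) * 1).
  rewrite (cp_iotaE act cp) -sumrB; apply: nrm_sum_fin => g.
  rewrite -mulrBl -(canAB cp); apply: nrm_mul_le; last exact: nrm_canU act cp g.
  by apply: le_trans (nrm_canA cp _) _; rewrite ler_pM2l // ltW // (sP g).2.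
have -> : N * (2 * (e / (4 * N)) * 1) = e / 2 by field; rewrite lt0r_neq0.
lra.
Qed.

End CrossedProductAF.

Theorem theorem2p2 (R : realType) (gT : finGroupType) (A : unitalCStarType R)
    (alpha : gT -> A -> A) (B : unitalCStarType R)
    (iota : {ffun gT -> A} -> B) :
  is_AF A -> is_cstar_action alpha -> strict_Rokhlin alpha ->
  is_crossed_product alpha iota -> is_AF B.
Proof.
move=> af act rok cp.
have [I [b sep]] := crossed_product_separable act cp af.
exact: locally_findim_AF sep (crossed_product_locally_findim act cp af rok).
Qed.
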